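(* Let $Z_1=V_2/V_1$, $Z_2=X_{a_1}/V_1$, $Z_3=X_{a_2}/V_1$, let $\phi_3$ be a positive measurable function on $(0,\infty)\times\mathbb{R}^2$, and let $\delta_{\phi_3}=\phi_3(Z_1,Z_2,Z_3)V_1$ be the corresponding estimator of $\sigma_1$. Let $U\sim \mathrm{Gamma}(b-a+3,1)$ and let $\beta_2$ be the unique solution of $E L'(U\beta_2)=0$. For $z_1,z_2,z_3>0$ define $$\phi_3^*(z_1,z_2,z_3)=\min\{\phi_3(z_1,z_2,z_3),\ \beta_2(1+z_1+(n_1-a_1+1)z_2+(n_2-a_2+1)z_3)\}.$$ Then the estimator $$\delta_{\phi_3^*}=\begin{cases}\phi_3^*(Z_1,Z_2,Z_3)V_1, & Z_i>0,\ i=1,2,3,\\ \phi_3(Z_1,Z_2,Z_3)V_1, & \text{otherwise,}\end{cases}$$ dominates $\delta_{\phi_3}$ with respect to the scale invariant loss $L$, provided that the event $\{Z_i>0,\ i=1,2,3,\ \phi_3(Z_1,Z_2,Z_3)>\beta_2(1+Z_1+(n_1-a_1+1)Z_2+(n_2-a_2+1)Z_3)\}$ has nonzero probability.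
   Context: Fix integers $1\le a_i<b_i\le n_i$, $i=1,2$, and put $a=a_1+a_2$, $b=b_1+b_2$. The unknown parameter is $\theta=(\mu_1,\mu_2,\sigma_1,\sigma_2)$ with $\mu_1,\mu_2\in\mathbb{R}$ and $0<\sigma_1\le\sigma_2$. From a random sample of size $n_i$ from the exponential distribution with density $\sigma_i^{-1}e^{-(x-\mu_i)/\sigma_i}$, $x>\mu_i$, one observes only the order statistics of ranks $a_i,\dots,b_i$ (doubly type-II censored sample). A complete sufficient statistic is $(X_{a_1},X_{a_2},V_1,V_2)$, consisting of four independent random variables, where $X_{a_i}$ has density $$\frac{n_i!}{(a_i-1)!(n_i-a_i)!}\Big[1-e^{-\frac{x-\mu_i}{\sigma_i}}\Big]^{a_i-1}\frac1{\sigma_i}\Big[e^{-\frac{x-\mu_i}{\sigma_i}}\Big]^{n_i-a_i+1},\quad x>\mu_i,$$ and $V_i$ has the gamma distribution with shape $b_i-a_i$ and scale $\sigma_i$. $\mathrm{Gamma}(k,1)$ denotes the gamma distribution with shape $k$ and scale $1$. The loss for estimating $\sigma_1$ by $\delta$ is $L(\delta/\sigma_1)$, where $L$ is differentiable and: (i) $L(t)$ is bowl-shaped with minimum value $0$ attained at $t=1$, decreasing for $t\le1$ and increasing for $t\ge1$; (ii) all integrals involving $L$ are finite and differentiation under the integral sign is permissible. The risk is $R(\theta,\delta)=E_\theta L(\delta/\sigma_1)$. An estimator $\delta$ dominates $\delta'$ if $R(\theta,\delta)\le R(\theta,\delta')$ for all $\theta$, with strict inequality for at least one $\theta$. *)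

(* Defs.v *)
From HB Require Import structures.
From mathcomp Require Export all_boot all_order all_algebra.
From mathcomp Require Export all_classical all_reals all_analysis.
Export Order.TTheory GRing.Theory Num.Theory.
Export numFieldNormedType.Exports.

Set Implicit Arguments.
Unset Strict Implicit.
Unset Printing Implicit Defensive.

Local Open Scope classical_set_scope.
Local Open Scope ring_scope.

Record exp_param (R : Type) := ExpParam {
  mu1 : R; mu2 : R; sigma1 : R; sigma2 : R }.

Definition in_Theta (R : realType) (theta : exp_param R) : Prop :=
  0 < sigma1 theta /\ sigma1 theta <= sigma2 theta.

(* [k] is the shape and [s] the scale; the normalising constant is
   Gamma(k) s^k with Gamma(k) = (k - 1)!, for an integer [k >= 1]. *)
Definition gamma_pdf (R : realType) (k : nat) (s : R) : R -> R :=
  (fun x => x ^+ k.-1 * expR (- (x / s)) / ((k.-1)`!%:R * s ^+ k))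
    \_ `]0, +oo[.

(* Density of the [a]-th order statistic of a sample of size [n] from the
   exponential distribution with location [mu] and scale [s]. *)
Definition exp_order_stat_pdf (R : realType) (n a : nat) (mu s : R) : R -> R :=
  (fun x => n`!%:R / ((a - 1)`!%:R * (n - a)`!%:R)
            * (1 - expR (- ((x - mu) / s))) ^+ (a - 1)
            * s^-1 * expR (- ((x - mu) / s)) ^+ (n - a + 1))
    \_ `]mu, +oo[.

Definition has_density d (T : measurableType d) (R : realType)
    (P : probability T R) (X : {mfun T >-> R}) (f : R -> R) : Prop :=
  forall A : set R, measurable A ->
    distribution P X A = (\int[lebesgue_measure]_(x in A) (f x)%:E)%E.

(* The events of a subfamily are obtained by taking the other sets to be
   [setT]. *)
Definition independent4 d (T : measurableType d) (R : realType)
    (P : probability T R) (X1 X2 X3 X4 : {mfun T >-> R}) : Prop :=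
  forall A1 A2 A3 A4 : set R,
    measurable A1 -> measurable A2 -> measurable A3 -> measurable A4 ->
    P (X1 @^-1` A1 `&` X2 @^-1` A2 `&` X3 @^-1` A3 `&` X4 @^-1` A4) =
    (P (X1 @^-1` A1) * P (X2 @^-1` A2) * P (X3 @^-1` A3) * P (X4 @^-1` A4))%E.

(* [X1], [X2] stand for X_{a_1}, X_{a_2}; the same statistics are used for all
   parameters, only the probability [P theta] varies. *)
Definition censored_exp_model d (T : measurableType d) (R : realType)
    (a1 b1 n1 a2 b2 n2 : nat) (P : exp_param R -> probability T R)
    (X1 X2 V1 V2 : {mfun T >-> R}) : Prop :=
  forall theta, in_Theta theta ->
    [/\ has_density (P theta) X1
          (exp_order_stat_pdf n1 a1 (mu1 theta) (sigma1 theta)),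
        has_density (P theta) X2
          (exp_order_stat_pdf n2 a2 (mu2 theta) (sigma2 theta)),
        has_density (P theta) V1 (gamma_pdf (b1 - a1) (sigma1 theta)),
        has_density (P theta) V2 (gamma_pdf (b2 - a2) (sigma2 theta)) &
        independent4 (P theta) X1 X2 V1 V2].

(* [E f(U)] for [U ~ Gamma(k, 1)]. *)
Definition gamma_mean (R : realType) (k : nat) (f : R -> R) : R :=
  \int[lebesgue_measure]_(x in `]0, +oo[) (f x * gamma_pdf k 1 x).

Definition gamma_integrable (R : realType) (k : nat) (f : R -> R) : Prop :=
  lebesgue_measure.-integrable `]0, +oo[
    (fun x => (f x * gamma_pdf k 1 x)%:E).

(* Only the values of [L] on (0, +oo) matter. The value 0 at 1 is the minimum by
   the two monotonicity clauses. *)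
Definition bowl_shaped (R : realType) (L : R -> R) : Prop :=
  [/\ L 1 = 0,
      forall s t, 0 < s -> s <= t -> t <= 1 -> L t <= L s &
      forall s t, 1 <= s -> s <= t -> L s <= L t].

(* For [W ~ Gamma(k, 1)], finiteness of E L(cW) and E W L'(cW), and
   d/dc E L(cW) = E W L'(cW). Since E W f(W) = k E f(U) for U ~ Gamma(k + 1, 1),
   the second clause is the finiteness of E L'(cU). *)
Definition regular_at_shape (R : realType) (L : R -> R) (k : nat) : Prop :=
  forall c : R, 0 < c ->
    [/\ gamma_integrable k (fun x => L (c * x)),
        gamma_integrable k (fun x => x * derive1 L (c * x)) &
        is_derive c 1 (fun c' : R => gamma_mean k (fun x => L (c' * x)))
          (gamma_mean k (fun x => x * derive1 L (c * x)))].

Definition risk d (T : measurableType d) (R : realType)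
    (P : exp_param R -> probability T R) (L : R -> R)
    (theta : exp_param R) (delta : T -> R) : \bar R :=
  'E_(P theta)[fun w => L (delta w / sigma1 theta)].

Definition dominates d (T : measurableType d) (R : realType)
    (P : exp_param R -> probability T R) (L : R -> R)
    (delta delta' : T -> R) : Prop :=
  (forall theta, in_Theta theta ->
     (risk P L theta delta <= risk P L theta delta')%E) /\
  (exists theta, in_Theta theta /\
     (risk P L theta delta < risk P L theta delta')%E).

Definition Z1 (T : Type) (R : realType) (V1 V2 : T -> R) (w : T) : R :=
  V2 w / V1 w.
Definition Z2 (T : Type) (R : realType) (X1 V1 : T -> R) (w : T) : R :=
  X1 w / V1 w.
Definition Z3 (T : Type) (R : realType) (X2 V1 : T -> R) (w : T) : R :=
  X2 w / V1 w.

Definition Zvec (T : Type) (R : realType) (X1 X2 V1 V2 : T -> R) (w : T) :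
    R * R * R :=
  (Z1 V1 V2 w, Z2 X1 V1 w, Z3 X2 V1 w).

Definition all_pos (R : realType) (z : R * R * R) : bool :=
  [&& 0 < z.1.1, 0 < z.1.2 & 0 < z.2].

Definition threshold (R : realType) (n1 a1 n2 a2 : nat) (beta2 : R)
    (z : R * R * R) : R :=
  beta2 * (1 + z.1.1 + (n1 - a1 + 1)%:R * z.1.2 + (n2 - a2 + 1)%:R * z.2).

Definition phi3_star (R : realType) (n1 a1 n2 a2 : nat) (beta2 : R)
    (phi3 : R * R * R -> R) (z : R * R * R) : R :=
  Num.min (phi3 z) (threshold n1 a1 n2 a2 beta2 z).

Definition delta_phi3 (T : Type) (R : realType) (X1 X2 V1 V2 : T -> R)
    (phi3 : R * R * R -> R) (w : T) : R :=
  phi3 (Zvec X1 X2 V1 V2 w) * V1 w.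

Definition delta_phi3_star (T : Type) (R : realType) (n1 a1 n2 a2 : nat)
    (X1 X2 V1 V2 : T -> R) (beta2 : R) (phi3 : R * R * R -> R) (w : T) : R :=
  let z := Zvec X1 X2 V1 V2 w in
  if all_pos z then phi3_star n1 a1 n2 a2 beta2 phi3 z * V1 w
  else phi3 z * V1 w.

(* Main.v *)
From HB Require Import structures.
Require Import Defs.
From mathcomp Require Import measurable_realfun lebesgue_integral_fubini.
From mathcomp Require Import ring lra zify.

(** Condition on [Z = z]. When [z] is positive, the density of [V1] is a gamma
    kernel [w] of shape [b - a + 2] and rate [T / sigma1], where
    [T = 1 + z1 + (n1 - a1 + 1) z2 + (n2 - a2 + 1) z3], times a nondecreasing
    function [h]: this is where [sigma1 <= sigma2] enters. For [c' < c] the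
    difference [L (c v) - L (c' v)] changes sign once, from negative to positive, at
    some [v0], so its integral against [w h] is at least [h v0] times its integral
    against [w]. With [c = phi3 z / sigma1] and [c' = beta2 T / sigma1] the latter is
    a positive multiple of [M (phi3 z / T) - M beta2], where [M beta] is the mean of
    [L (beta W)] for [W] of law Gamma(b - a + 2, 1). Since [M' beta] is a positive
    multiple of [E L'(beta U)], which vanishes only at [beta2] and is nonnegative
    beyond it by the same crossing argument, [M] increases beyond [beta2]. *)

Set Implicit Arguments.
Unset Strict Implicit.
Unset Printing Implicit Defensive.

Local Open Scope classical_set_scope.
Local Open Scope ring_scope.

(** * Product measures and densities *)

(** The kernel [w] uses the rate 1 / sigma1 throughout, although [V2] and [X2] have scale sigma2.
    Removing it from their densities leaves the exponential of a nonnegative multiple of v (1 /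
    sigma1 - 1 / sigma2), which is nondecreasing in v; the order statistics also leave a power of 1
    - exp(- (x - mu_i) / sigma_i), again nondecreasing, and jump up from 0 at mu_i. The coefficients
    n_i - a_i + 1 of T are the tail exponents of these densities. The shape b - a + 2 comes from the
    powers b1 - a1 - 1 and b2 - a2 - 1 of v in the gamma densities and from the Jacobian v^3 of the
    passage from ([V2], [X1], [X2]) to the ratios.

    Two obstacles shape the proof. The integral for a single z may be infinite, so the crossing
    inequality is kept in the extended reals. And h may vanish at v0 when some mu_i is positive, so
    strictness is proved at one convenient parameter only. The truncation event is known to have
    positive probability at a possibly different parameter; it is carried over through Lebesgue
    measure, with respect to which Z has a density under every parameter. *)

Section measure.
Local Open Scope ereal_scope.
Import HBNNSimple.

(** Cutting a simple function below [f] to the complement of [N] keeps its integral and puts it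
    below the restriction of [f], so the two suprema agree. *)
Lemma ge0_integral_setC_null d (T : measurableType d) (R : realType)
    (mu : {measure set T -> \bar R}) (N : set T) (f : T -> \bar R) :
  measurable N -> mu N = 0 -> (forall x, 0 <= f x) ->
  \int[mu]_x f x = \int[mu]_(x in ~` N) f x.
Proof.
move=> mN N0 f0; rewrite [RHS]integral_mkcond.
have fN0 x : 0 <= (f \_ (~` N)) x by rewrite erestrict_ge0.
rewrite !ge0_integralTE//; apply/eqP; rewrite eq_le; apply/andP; split.
- apply: ge_ereal_sup => _ [h hf <-]; apply: ereal_sup_ubound.
  exists (proj_nnsfun h (measurableC mN)).
    move=> x; rewrite -mrestrict !patchE.
    by case: ifPn => _; rewrite ?hf.
  rewrite -!integralT_nnsfun (ge0_negligible_integral mN _ _ _ N0)//; last 2 first.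
  - exact/measurable_EFinP.
  - by move=> x _; rewrite lee_fin.
  rewrite [RHS](ge0_negligible_integral mN _ _ _ N0)//; last 2 first.
  - exact/measurable_EFinP.
  - by move=> x _; rewrite lee_fin.
  rewrite setTD; apply: eq_integral => x xN.
  by rewrite -mrestrict patchE xN.
- apply: ge_ereal_sup => _ [h hf <-]; apply: ereal_sup_ubound.
  exists h => // x; apply: (le_trans (hf x)); rewrite patchE.
  by case: ifPn => // _.
Qed.

(* [f] need not be measurable: the integral is a supremum over simple functions. *)
Lemma integral_setC_null d (T : measurableType d) (R : realType)
    (mu : {measure set T -> \bar R}) (N : set T) (f : T -> \bar R) :
  measurable N -> mu N = 0 ->
  \int[mu]_x f x = \int[mu]_(x in ~` N) f x.
Proof.
move=> mN N0; rewrite integralE [RHS]integralE.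
by congr (_ - _); apply: ge0_integral_setC_null.
Qed.

(** The hypothesis is the case of indicators; linearity extends it to simple functions, and monotone
    convergence along [nnsfun_approx] to [g]. *)
Lemma ge0_integral_density d (T : measurableType d) (R : realType)
    (mu nu : {measure set T -> \bar R}) (f : T -> R) :
  measurable_fun setT f -> (forall x, (0 <= f x)%R) ->
  (forall A, measurable A -> nu A = \int[mu]_(x in A) (f x)%:E) ->
  forall g : T -> \bar R, measurable_fun setT g -> (forall x, 0 <= g x) ->
  \int[nu]_x g x = \int[mu]_x (g x * (f x)%:E).
Proof.
move=> mf f0 nuE g mg g0.
pose g_ := nnsfun_approx measurableT mg.
have mfE : measurable_fun setT (EFin \o f) by exact/measurable_EFinP.
transitivity (limn (fun n => \int[nu]_x (g_ n x)%:E)).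
  rewrite -monotone_convergence//=.
  - by apply: eq_integral => x _; apply/esym/cvg_lim => //; exact: cvg_nnsfun_approx.
  - by move=> n; exact/measurable_EFinP.
  - by move=> n x _; rewrite lee_fin.
  - by move=> x _ a b ab; rewrite lee_fin; exact/lefP/nd_nnsfun_approx.
transitivity (limn (fun n => \int[mu]_x ((g_ n x)%:E * (f x)%:E))); last first.
  rewrite -monotone_convergence//=.
  - apply: eq_integral => x _; apply/cvg_lim => //.
    by apply: cvgeZr => //; exact: cvg_nnsfun_approx.
  - by move=> n; apply: emeasurable_funM => //; exact/measurable_EFinP.
  - by move=> n x _; rewrite mule_ge0// lee_fin.
  - move=> x _ a b ab; rewrite lee_wpmul2r ?lee_fin//.
    exact/lefP/nd_nnsfun_approx.
congr (limn _); apply/funext => n.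
have pre0 r x : 0 <= (r * \1_(g_ n @^-1` [set r]) x)%:E.
  by rewrite EFinM nnfun_muleindic_ge0.
under eq_integral do rewrite fimfunE -fsumEFin//.
rewrite ge0_integral_fsum//; last first.
  by move=> y; apply/measurable_EFinP/measurable_funM.
under [RHS]eq_integral => x _.
  rewrite fimfunE -fsumEFin// ge0_mule_fsuml//.
  over.
rewrite [RHS]ge0_integral_fsum//; last 2 first.
- move=> r; apply: emeasurable_funM => //.
  exact/measurable_EFinP/measurable_funM.
- by move=> r x _; rewrite mule_ge0// lee_fin.
apply: eq_fsbigr => r _.
rewrite integralZl_indic_nnsfun// integral_indic// setIT nuE//.
under [RHS]eq_integral do rewrite EFinM -muleA.
(* A negative [r] is not a value of [g_ n], so both sides vanish; for the others the sign allows [r]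
   to leave the integral. *)
have [r0|r0] := leP 0%R r; last first.
  rewrite preimage_nnfun0// integral_set0 mule0 integral0_eq// => x _.
  by rewrite indicE in_set0 mul0e mule0.
rewrite ge0_integralZl//; last 2 first.
- by apply: emeasurable_funM => //; exact/measurable_EFinP.
- by move=> x _; rewrite mule_ge0// lee_fin.
congr (_ * _); rewrite integral_mkcond; apply: eq_integral => x _.
by rewrite patchE indicE; case: ifPn => _; rewrite ?mul1e ?mul0e.
Qed.

(* The library's own sigma-finiteness instance of [m1 \x m2] is shadowed by the
   one for subprobabilities, hence this alias. *)
Section prod_measure.
Context d1 d2 (T1 : measurableType d1) (T2 : measurableType d2) (R : realType).
Variables (m1 : {sigma_finite_measure set T1 -> \bar R})
  (m2 : {sigma_finite_measure set T2 -> \bar R}).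

Definition prod_measure := m1 \x m2.

Lemma sigma_finite_prod_measure : sigma_finite setT prod_measure.
Proof.
by case: (
  lebesgue_integral_fubini.measure_function_Measure_isSigmaFinite__to__measure_function_isSigmaFinite m1 m2).
Qed.

HB.instance Definition _ := Measure.on prod_measure.
HB.instance Definition _ :=
  Measure_isSigmaFinite.Build _ _ _ prod_measure sigma_finite_prod_measure.

Lemma tonelli1 (f : T1 * T2 -> \bar R) :
  measurable_fun setT f -> (forall x, 0 <= f x) ->
  \int[prod_measure]_z f z = \int[m1]_x \int[m2]_y f (x, y).
Proof. exact: fubini_tonelli1. Qed.

Lemma tonelli2 (f : T1 * T2 -> \bar R) :
  measurable_fun setT f -> (forall x, 0 <= f x) ->
  \int[prod_measure]_z f z = \int[m2]_y \int[m1]_x f (x, y).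
Proof. exact: fubini_tonelli2. Qed.

Lemma measurable_integral1 (f : T1 * T2 -> \bar R) :
  measurable_fun setT f -> (forall x, 0 <= f x) ->
  measurable_fun setT (fun x => \int[m2]_y f (x, y)).
Proof. exact: measurable_fun_fubini_tonelli_F. Qed.

End prod_measure.

Lemma product_density d1 d2 (T1 : measurableType d1) (T2 : measurableType d2)
    (R : realType)
    (m1 : {sigma_finite_measure set T1 -> \bar R})
    (m2 : {sigma_finite_measure set T2 -> \bar R})
    (mu1 : {sigma_finite_measure set T1 -> \bar R})
    (mu2 : {sigma_finite_measure set T2 -> \bar R}) (f : T1 -> R) (g : T2 -> R) :
  measurable_fun setT f -> (forall x, (0 <= f x)%R) ->
  measurable_fun setT g -> (forall x, (0 <= g x)%R) ->
  (forall A, measurable A -> m1 A = \int[mu1]_(x in A) (f x)%:E) ->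
  (forall A, measurable A -> m2 A = \int[mu2]_(x in A) (g x)%:E) ->
  forall D, measurable D ->
  prod_measure m1 m2 D = \int[prod_measure mu1 mu2]_(z in D) (f z.1 * g z.2)%:E.
Proof.
move=> mf f0 mg g0 m1E m2E D mD.
rewrite [LHS] /product_measure1.
rewrite (ge0_integral_density mf f0 m1E)//; last exact: measurable_fun_xsection.
rewrite [RHS]integral_mkcond tonelli1//; last 2 first.
- apply/(measurable_restrictT _ _).1 => //; apply: measurable_funTS.
  apply/measurable_EFinP; apply: measurable_funM => /=.
    exact: measurableT_comp measurable_fst.
  exact: measurableT_comp measurable_snd.
- by move=> x; rewrite erestrict_ge0// => z; rewrite lee_fin mulr_ge0.
apply: eq_integral => x _; rewrite /=.
rewrite m2E; last exact: measurable_xsection.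
rewrite -ge0_integralZr//; last 4 first.
- exact: measurable_xsection.
- exact/measurable_funTS/measurable_EFinP.
- by move=> y _; rewrite lee_fin.
- by rewrite lee_fin.
rewrite integral_mkcond; apply: eq_integral => y _.
rewrite !patchE mem_xsection; case: ifPn => // _.
by rewrite /= EFinM muleC.
Qed.

Definition pushforward_measure d1 d2 (T1 : measurableType d1)
    (T2 : measurableType d2) (R : realType) (m : {measure set T1 -> \bar R})
    (f : T1 -> T2) (mf : measurable_fun setT f) : {measure set T2 -> \bar R} :=
  measure_function_pushforward__canonical__measure_function_Measure m mf.

(** [E] stands for an event about the variables not yet paired, which lets the lemma be iterated
    over four variables. The law of the pair under [P] conditioned on [E] agrees with the product
    measure on rectangles, hence everywhere. *)
Lemma indep_product d d1 d2 (T : measurableType d) (T1 : measurableType d1)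
    (T2 : measurableType d2) (R : realType) (P : probability T R)
    (Y1 : T -> T1) (Y2 : T -> T2) (E : set T)
    (m1 : {sigma_finite_measure set T1 -> \bar R})
    (m2 : {sigma_finite_measure set T2 -> \bar R}) :
  measurable_fun setT Y1 -> measurable_fun setT Y2 -> measurable E ->
  (forall A B, measurable A -> measurable B ->
    P (Y1 @^-1` A `&` Y2 @^-1` B `&` E) = m1 A * m2 B * P E) ->
  forall D, measurable D ->
    P ((fun w => (Y1 w, Y2 w)) @^-1` D `&` E) = prod_measure m1 m2 D * P E.
Proof.
move=> mY1 mY2 mE H D mD.
have mY : measurable_fun setT (fun w => (Y1 w, Y2 w)).
  exact: measurable_fun_pair.
(* Conditioning on a null event is impossible, but then both sides are 0. *)
have [PE0|PE0] := eqVneq (P E) 0.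
  rewrite PE0 mule0; apply: (subset_measure0 _ mE _ PE0); last exact: subIsetr.
  by apply: measurableI => //; rewrite -[X in measurable X]setTI; exact: mY.
have PEfin : P E \is a fin_num by exact: fin_num_measure.
have r0 : (0 < fine (P E))%R.
  by rewrite fine_gt0 // lt0e PE0 measure_ge0 ltey_eq PEfin.
have r0' : (0 <= (fine (P E))^-1)%R by rewrite invr_ge0 ltW.
pose m' := mscale (NngNum r0') (pushforward_measure (mrestr P mE) mY).
have m'E F : m' F = (fine (P E))^-1%:E * P ((fun w => (Y1 w, Y2 w)) @^-1` F `&` E).
  by [].
have -> : prod_measure m1 m2 D = m' D.
  apply: product_measure_unique => // A B mA mB.
  apply: (etrans (m'E _)); rewrite H// muleC -muleA.
  by rewrite -[X in _ * (X * _)](fineK PEfin) -EFinM divff ?mule1// gt_eqF.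
rewrite m'E muleC muleA.
by rewrite -[X in X * _ * _](fineK PEfin) -EFinM divff ?mul1e// gt_eqF.
Qed.
End measure.

(** Infinite values are allowed, so the gap [g - f] is formed only on the part [S'] of [S] where [g]
    is finite. The rest of [S] is null because [g] has a finite integral; if the positive gap
    integrated to 0, then [S'], and with it [S], would be null. *)
Lemma lt_integral_on d (T : measurableType d) (R : realType)
    (mu : {measure set T -> \bar R}) (S : set T) (f g : T -> \bar R) :
  measurable S -> mu S <> 0%E ->
  measurable_fun setT f -> measurable_fun setT g ->
  (forall x, 0 <= f x)%E -> (forall x, f x <= g x)%E ->
  (\int[mu]_x g x < +oo)%E ->
  (forall x, S x -> (g x < +oo)%E -> (f x < g x)%E) ->
  (\int[mu]_x f x < \int[mu]_x g x)%E.
Proof.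
move=> mS muS mf mg f0 fg goo flt.
have g0 x : (0 <= g x)%E by exact: le_trans (fg x).
pose S' := S `&` [set x | (g x < +oo)%E].
have mS' : measurable S'.
  apply: measurableI => //; rewrite -[X in measurable X]setTI.
  exact: emeasurable_fun_infty_o.
pose k := (fun x => g x - f x)%E \_ S'.
have mk : measurable_fun setT k.
  apply/(measurable_restrictT _ _).1 => //; apply: measurable_funTS.
  exact: emeasurable_funB.
have fin x : S' x -> f x \is a fin_num /\ g x \is a fin_num.
  by move=> [_ /= gx]; rewrite !ge0_fin_numE// gx (le_lt_trans (fg x)).
have k_gt0 x : S' x -> (0 < k x)%E.
  move=> S'x; rewrite /k patchE mem_set//; have [ff gf] := fin x S'x.
  by rewrite sube_gt0; case: S'x => Sx gx; exact: flt.
have k0 x : (0 <= k x)%E.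
  have [xS|xS] := pselect (S' x); first by rewrite ltW// k_gt0.
  by rewrite /k patchE memNset.
have fkg x : (f x + k x <= g x)%E.
  rewrite /k patchE; case: ifPn => [/set_mem xS|_]; last by rewrite adde0.
  by have [ff gf] := fin x xS; rewrite addeC subeK.
have le1 : (\int[mu]_x f x + \int[mu]_x k x <= \int[mu]_x g x)%E.
  rewrite -ge0_integralD//; apply: ge0_le_integral => //.
  - by move=> x _; rewrite adde_ge0.
  - exact: emeasurable_funD.
have k_int : (0 < \int[mu]_x k x)%E.
  rewrite lt0e integral_ge0// andbT; apply/eqP => k_int0.
  apply: muS; have S'0 : mu S' = 0%E.
    have /(ae_eq_integral_abs mu measurableT mk)[N [mN N0 kN]] :
        (\int[mu]_x `|k x| = 0)%E.
      by rewrite -k_int0; apply: eq_integral => x _; rewrite gee0_abs.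
    apply: (subset_measure0 _ mN _ N0) => // x xS; apply: kN => /= /(_ I) kx0.
    by have := k_gt0 x xS; rewrite kx0 ltxx.
  have gi : mu.-integrable setT g.
    by apply/integrableP; split => //; under eq_integral do rewrite gee0_abs//.
  have [N [mN N0 gN]] := integrable_ae measurableT gi.
  apply: (subset_measure0 mS (measurableU _ _ mS' mN) _
    (etrans (measureU0 mS' mN N0) S'0)).
  move=> x Sx; have [gx|gx] := pselect (g x < +oo)%E; [by left|right].
  apply: gN => /= /(_ I); apply: contra_not gx => gx.
  by rewrite ltey; apply: contraTneq gx => ->.
have foo : (\int[mu]_x f x < +oo)%E.
  by apply: le_lt_trans goo; apply: ge0_le_integral.
apply: lt_le_trans le1; rewrite lteDl// ge0_fin_numE//.
exact: integral_ge0.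
Qed.

(* [lebesgue_measure] lives on [measurableTypeR R], whose display differs from the
   one that [distribution] and products of [R] use; [leb] is its copy there. *)
Section leb.
Context (R : realType).

Lemma measurable_id_measurableTypeR :
  measurable_fun setT (idfun : measurableTypeR R -> R).
Proof. by move=> _ A mA; rewrite setTI. Qed.

Definition leb : set R -> \bar R :=
  pushforward_measure (@lebesgue_measure R) measurable_id_measurableTypeR.
HB.instance Definition _ := Measure.on leb.

Lemma sigma_finite_leb : sigma_finite setT leb.
Proof. exact: (sigma_finiteT (@lebesgue_measure R)). Qed.

HB.instance Definition _ := Measure_isSigmaFinite.Build _ _ _ leb sigma_finite_leb.

Lemma ge0_integral_leb (D : set R) (f : R -> \bar R) :
  measurable D -> measurable_fun D f -> (forall x, D x -> (0 <= f x)%E) ->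
  (\int[leb]_(x in D) f x = \int[lebesgue_measure]_(x in D) f x)%E.
Proof.
move=> mD mf f0; rewrite (ge0_integral_pushforward measurable_id_measurableTypeR)//.
by move=> x xD; exact: f0 (set_mem xD).
Qed.

Definition leb3 : {sigma_finite_measure set (R * R * R)%type -> \bar R} :=
  prod_measure (prod_measure leb leb) leb.

End leb.
Arguments leb : clear implicits.

(** * Rescaling Lebesgue measure *)

Section scaling.
Local Open Scope ereal_scope.

(** The image of Lebesgue measure under multiplication by [v], times [v], has the value b - a on ]a,
    b], so it is Lebesgue measure. *)
Lemma ge0_integral_scale (R : realType) (v : R) (h : R -> \bar R) :
  (0 < v)%R -> measurable_fun setT h -> (forall x, 0 <= h x) ->
  \int[lebesgue_measure]_x h x = v%:E * \int[lebesgue_measure]_x h (v * x)%R.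
Proof.
move=> v0 mh h0.
have mv : measurable_fun setT ( *%R v : measurableTypeR R -> measurableTypeR R).
  exact: mulrl_measurable.
pose m := mscale (NngNum (ltW v0)) (pushforward_measure lebesgue_measure mv).
rewrite (eq_measure_integral m) => [|A mA _].
  rewrite ge0_integral_mscale//; congr (_ * _).
  by rewrite ge0_integral_pushforward.
apply: lebesgue_measure_unique => // _ [[a b]] _ <-.
have mE B : m B = v%:E * lebesgue_measure ( *%R v @^-1` B) by [].
apply: esym (etrans (mE _) _) => /=.
rewrite (_ : _ @^-1` _ = `](a / v)%R, (b / v)%R]%classic); last first.
  by apply/seteqP; split=> x /=; rewrite !in_itv/= ltr_pdivrMr// ler_pdivlMr// mulrC.
rewrite !lebesgue_measure_itv/= !lte_fin ltr_pM2r ?invr_gt0//.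
case: ifPn => _; last by rewrite mule0.
by rewrite -!EFinD -EFinM; congr EFin; field; rewrite gt_eqF.
Qed.

Lemma ge0_integral_leb_scale (R : realType) (v : R) (h : R -> \bar R) :
  (0 < v)%R -> measurable_fun setT h -> (forall x, 0 <= h x) ->
  \int[leb R]_x h x = v%:E * \int[leb R]_x h (v * x)%R.
Proof.
move=> v0 mh h0; rewrite !ge0_integral_leb//; first exact: ge0_integral_scale.
by apply: measurableT_comp => //; exact: mulrl_measurable.
Qed.

(** The scalings are abstract maps, so that two applications reach the triple product [leb3]. *)
Lemma ge0_integral_scale_product d1 d2 (T1 : measurableType d1)
    (T2 : measurableType d2) (R : realType)
    (m1 : {sigma_finite_measure set T1 -> \bar R})
    (m2 : {sigma_finite_measure set T2 -> \bar R})
    (s1 : T1 -> T1) (s2 : T2 -> T2) (c1 c2 : R) :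
  (0 <= c1)%R -> (0 <= c2)%R ->
  measurable_fun setT s1 -> measurable_fun setT s2 ->
  (forall h, measurable_fun setT h -> (forall x, 0 <= h x) ->
     \int[m1]_x h x = c1%:E * \int[m1]_x h (s1 x)) ->
  (forall h, measurable_fun setT h -> (forall x, 0 <= h x) ->
     \int[m2]_x h x = c2%:E * \int[m2]_x h (s2 x)) ->
  forall h, measurable_fun setT h -> (forall x, 0 <= h x) ->
     \int[prod_measure m1 m2]_x h x =
     (c1 * c2)%:E * \int[prod_measure m1 m2]_x h (s1 x.1, s2 x.2).
Proof.
move=> c10 c20 ms1 ms2 H1 H2 h mh h0.
have ms : measurable_fun setT (fun x : T1 * T2 => (s1 x.1, s2 x.2)).
  apply: measurable_fun_pair.
    exact: measurableT_comp measurable_fst.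
  exact: measurableT_comp measurable_snd.
have mh2 : measurable_fun setT (fun x => h (x.1, s2 x.2)).
  apply: measurableT_comp => //; apply: measurable_fun_pair => //.
  exact: measurableT_comp measurable_snd.
have mH := measurable_integral1 m2 mh2 (fun x => h0 _).
rewrite tonelli1// tonelli1//; last exact: measurableT_comp ms.
rewrite /=.
under eq_integral => x _.
  rewrite H2//; last exact: measurableT_comp (pair1_measurable x).
  over.
rewrite ge0_integralZl//; last by move=> x _; exact: integral_ge0.
rewrite [X in _ * X]H1//; last by move=> x; exact: integral_ge0.
by rewrite muleA -EFinM mulrC.
Qed.

End scaling.

Lemma measurable_invr (R : realType) : measurable_fun [set: R] (@GRing.inv R).
Proof.
rewrite -(setUv [set 0%R : R]) measurable_funU//; last exact: measurableC.
split; first exact: measurable_fun_set1.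
apply: open_continuous_measurable_fun; first exact/closed_openC.
by move=> x /set_mem/eqP x0; exact: inv_continuous.
Qed.

(** * Joint law of three ratios and their denominator *)

Section law.
Local Open Scope ereal_scope.
Context d (T : measurableType d) (R : realType) (P : probability T R).
Variables (Y1 Y2 Y3 Y4 : {mfun T >-> R}) (f1 f2 f3 f4 : R -> R).
Hypotheses (mf1 : measurable_fun setT f1) (mf2 : measurable_fun setT f2)
  (mf3 : measurable_fun setT f3) (mf4 : measurable_fun setT f4).
Hypotheses (f1_ge0 : forall x, (0 <= f1 x)%R) (f2_ge0 : forall x, (0 <= f2 x)%R)
  (f3_ge0 : forall x, (0 <= f3 x)%R) (f4_ge0 : forall x, (0 <= f4 x)%R).
Hypotheses (Y1f : has_density P Y1 f1) (Y2f : has_density P Y2 f2)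
  (Y3f : has_density P Y3 f3) (Y4f : has_density P Y4 f4).
Hypothesis indep : independent4 P Y1 Y2 Y3 Y4.

(** The joint law is built as an iterated product, one variable at a time; [law2] and [law3] carry
    the events of the remaining variables along as the set [E] of [indep_product]. *)
Lemma ge0_integral_joint_density (F : (R * R * R * R)%type -> \bar R) :
  measurable_fun setT F -> (forall x, 0 <= F x) ->
  \int[P]_w F (Y1 w, Y2 w, Y3 w, Y4 w) =
  \int[prod_measure (leb3 R) (leb R)]_x
    (F x * (f1 x.1.1.1 * f2 x.1.1.2 * f3 x.1.2 * f4 x.2)%:E).
Proof.
move=> mF F0.
have pT (Y : {mfun T >-> R}) : P (Y @^-1` setT) = 1.
  by rewrite preimage_setT probability_setT.
have mY (Y : {mfun T >-> R}) A : measurable A -> measurable (Y @^-1` A).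
  by move=> mA; rewrite -[X in measurable X]setTI; exact: measurable_funP.
have mYs (Y : {mfun T >-> R}) : measurable_fun setT Y by exact: measurable_funP.
pose D1 : {sigma_finite_measure set R -> \bar R} := distribution P Y1.
pose D2 : {sigma_finite_measure set R -> \bar R} := distribution P Y2.
pose D3 : {sigma_finite_measure set R -> \bar R} := distribution P Y3.
pose D4 : {sigma_finite_measure set R -> \bar R} := distribution P Y4.
pose M12 : {sigma_finite_measure set (R * R)%type -> \bar R} := prod_measure D1 D2.
pose M123 : {sigma_finite_measure set (R * R * R)%type -> \bar R} :=
  prod_measure M12 D3.
have indep_last A B : measurable A -> measurable B -> 
    P (Y3 @^-1` A `&` Y4 @^-1` B) = P (Y3 @^-1` A) * P (Y4 @^-1` B).
  move=> mA mB; have := indep measurableT measurableT mA mB.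
  by rewrite !pT !preimage_setT !setTI !mul1e.
have law2 A B : measurable A -> measurable B -> forall D, measurable D ->
    P ((fun w => (Y1 w, Y2 w)) @^-1` D `&` (Y3 @^-1` A `&` Y4 @^-1` B)) =
    M12 D * P (Y3 @^-1` A `&` Y4 @^-1` B).
  move=> mA mB; apply: indep_product => //.
    by apply: measurableI; exact: mY.
  move=> A' B' mA' mB'.
  by rewrite indep_last// !setIA indep// !muleA.
have m12 : measurable_fun setT (fun w => (Y1 w, Y2 w)).
  exact: measurable_fun_pair.
have law3 B : measurable B -> forall D, measurable D ->
    P ((fun w => (Y1 w, Y2 w, Y3 w)) @^-1` D `&` Y4 @^-1` B) =
    M123 D * P (Y4 @^-1` B).
  move=> mB; apply: (@indep_product _ _ _ T _ _ R P (fun w => (Y1 w, Y2 w)) Y3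
    _ M12 D3) => //.
    exact: mY.
  move=> A' B' mA' mB'.
  by rewrite -setIA law2// indep_last// muleA.
have m123 : measurable_fun setT (fun w => (Y1 w, Y2 w, Y3 w)).
  exact: measurable_fun_pair.
have law4 D : measurable D ->
    P ((fun w => (Y1 w, Y2 w, Y3 w, Y4 w)) @^-1` D) =
    prod_measure M123 D4 D.
  move=> mD; rewrite -[LHS](congr1 P (setIT _)).
  rewrite (@indep_product _ _ _ T _ _ R P
    (fun w => (Y1 w, Y2 w, Y3 w)) Y4 setT M123 D4)//.
    by rewrite probability_setT mule1.
  by move=> A B mA mB; rewrite setIT law3// probability_setT mule1.
have m1234 : measurable_fun setT (fun w => (Y1 w, Y2 w, Y3 w, Y4 w)).
  exact: measurable_fun_pair.
have mfst n1 n2 (T1 : measurableType n1) (T2 : measurableType n2) (f : T1 -> R) :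
    measurable_fun setT f -> measurable_fun setT (fun x : T1 * T2 => f x.1).
  by move=> mf; exact: measurableT_comp measurable_fst.
have msnd n1 n2 (T1 : measurableType n1) (T2 : measurableType n2) (f : T2 -> R) :
    measurable_fun setT f -> measurable_fun setT (fun x : T1 * T2 => f x.2).
  by move=> mf; exact: measurableT_comp measurable_snd.
transitivity (\int[pushforward_measure P m1234]_x F x).
  by rewrite ge0_integral_pushforward.
pose p2 (x : (R * R)%type) := (f1 x.1 * f2 x.2)%R.
pose p3 (x : (R * R * R)%type) := (p2 x.1 * f3 x.2)%R.
have mp2 : measurable_fun setT p2.
  by apply: measurable_funM; [exact: mfst|exact: msnd].
have mp3 : measurable_fun setT p3.
  by apply: measurable_funM; [exact: mfst|exact: msnd].
have densE (Y : {mfun T >-> R}) (f : R -> R) :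
    measurable_fun setT f -> (forall x, (0 <= f x)%R) ->
    has_density P Y f -> forall A, measurable A ->
    distribution P Y A = \int[leb R]_(x in A) (f x)%:E.
  move=> mf f_ge0 Yf A mA.
  rewrite ge0_integral_leb//; last by move=> x _; rewrite lee_fin.
    exact: Yf.
  exact/measurable_funTS/measurable_EFinP.
apply: ge0_integral_density => //.
- by apply: measurable_funM; [apply: (mfst _ _ _ _ p3)|exact: msnd].
- by move=> x; rewrite !mulr_ge0.
move=> A mA; apply: (etrans (law4 _ mA)).
apply: (product_density mp3) => //;
  [by move=> x; rewrite !mulr_ge0| |by move=> B mB; exact: densE].
apply: (product_density mp2) => //;
  [by move=> x; rewrite !mulr_ge0| |by move=> B mB; exact: densE].
by apply: product_density => // B mB; exact: densE.
Qed.


Lemma ge0_integral_leb3_scale (v : R) (h : (R * R * R)%type -> \bar R) :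
  (0 < v)%R -> measurable_fun setT h -> (forall x, 0 <= h x) ->
  \int[leb3 R]_x h x =
  (v ^+ 3)%:E * \int[leb3 R]_x h (v * x.1.1, v * x.1.2, v * x.2)%R.
Proof.
move=> v0 mh h0; have mv := @mulrl_measurable R setT v.
have mv2 : measurable_fun setT (fun x : (R * R)%type => (v * x.1, v * x.2)%R).
  by apply: measurable_fun_pair; apply: measurableT_comp.
have := @ge0_integral_scale_product _ _ _ _ _ (prod_measure (leb R) (leb R))
  (leb R) _ ( *%R v) (v * v) v (mulr_ge0 (ltW v0) (ltW v0)) (ltW v0) mv2 mv.
rewrite exprS expr2 mulrA; apply => //.
- move=> k mk k0.
  by rewrite (@ge0_integral_scale_product _ _ _ _ _ (leb R) (leb R) ( *%R v)
    ( *%R v) v v)// ?ltW// => l ml l0; exact: ge0_integral_leb_scale.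
- by move=> l ml l0; exact: ge0_integral_leb_scale.
Qed.

Definition joint_density (x : (R * R * R * R)%type) : R :=
  (f1 x.1.1.1 * f2 x.1.1.2 * f3 x.1.2 * f4 x.2)%R.

Lemma measurable_joint_density : measurable_fun setT joint_density.
Proof.
apply: measurable_funM; first (apply: measurable_funM; first apply: measurable_funM).
- by do 3 apply: measurableT_comp => //.
- by do 3 apply: measurableT_comp => //.
- by do 2 apply: measurableT_comp => //.
- by apply: measurableT_comp => //.
Qed.

(** Density of (Y1 / Y4, Y2 / Y4, Y3 / Y4, Y4). The cube is the Jacobian of multiplication by [x.2]
    in three coordinates. *)
Definition ratio_density (x : (R * R * R * R)%type) : R :=
  (x.2 ^+ 3 * joint_density (x.2 * x.1.1.1, x.2 * x.1.1.2, x.2 * x.1.2, x.2))%R.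

Lemma measurable_ratio_density : measurable_fun setT ratio_density.
Proof.
apply: measurable_funM; first exact: measurable_funX.
apply: measurableT_comp => //; first exact: measurable_joint_density.
repeat apply: measurable_fun_pair => //; apply: measurable_funM => //.
- by do 2 apply: measurableT_comp => //.
- by do 2 apply: measurableT_comp => //.
- by apply: measurableT_comp => //.
Qed.

Lemma ratio_density_ge0 x : (forall v, (v <= 0)%R -> f4 v = 0%R) ->
  (0 <= ratio_density x)%R.
Proof.
move=> f40; rewrite /ratio_density /joint_density /=.
have [x0|x0] := leP x.2 0%R; first by rewrite f40// !mulr0.
by rewrite !mulr_ge0// ltW.
Qed.

Lemma ge0_integral_ratio_density (G : (R * R * R * R)%type -> \bar R) :
  measurable_fun setT G -> (forall x, 0 <= G x) ->
  (forall v, (v <= 0)%R -> f4 v = 0%R) ->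
  \int[P]_w G (Y1 w / Y4 w, Y2 w / Y4 w, Y3 w / Y4 w, Y4 w)%R =
  \int[leb3 R]_z \int[leb R]_v (G (z, v) * (ratio_density (z, v))%:E).
Proof.
move=> mG G0 f40.
pose H (x : (R * R * R * R)%type) :=
  G (x.1.1.1 / x.2, x.1.1.2 / x.2, x.1.2 / x.2, x.2)%R.
have mH : measurable_fun setT H.
  apply: measurableT_comp => //.
  repeat apply: measurable_fun_pair => //; apply: measurable_funM => //.
  - by do 2 apply: measurableT_comp => //.
  - by apply: measurableT_comp => //; exact: measurable_invr.
  - by do 2 apply: measurableT_comp => //.
  - by apply: measurableT_comp => //; exact: measurable_invr.
  - by apply: measurableT_comp => //.
  - by apply: measurableT_comp => //; exact: measurable_invr.
rewrite (ge0_integral_joint_density mH) => [|x]; last exact: G0.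
have mp := measurable_joint_density; have mq := measurable_ratio_density.
have q0 x := ratio_density_ge0 x f40.
have mHp : measurable_fun setT (fun x => H x * (joint_density x)%:E).
  by apply: emeasurable_funM => //; exact/measurable_EFinP.
have Hp0 x : 0 <= H x * (joint_density x)%:E.
  by rewrite mule_ge0 ?G0// lee_fin !mulr_ge0.
have mGq : measurable_fun setT (fun x => G x * (ratio_density x)%:E).
  by apply: emeasurable_funM => //; exact/measurable_EFinP.
have Gq0 x : 0 <= G x * (ratio_density x)%:E.
  by rewrite mule_ge0// lee_fin.
(* The denominator is moved to the outer integral: for a fixed [v] the change of variables is a mere
   rescaling of [leb3]. *)
rewrite [LHS](tonelli2 (leb3 R) (leb R) mHp)//.
have E := etrans (esym (tonelli1 (leb3 R) (leb R) mGq Gq0))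
  (tonelli2 (leb3 R) (leb R) mGq Gq0).
apply: etrans (esym E).
apply: eq_integral => v _.
have [v0|v0] := leP v 0%R.
  rewrite !integral0_eq// => x _.
    by rewrite /ratio_density /joint_density /= f40// !mulr0 mule0.
  by rewrite /joint_density /= f40// mulr0 mule0.
rewrite (ge0_integral_leb3_scale v0); last 2 first.
- exact: (measurableT_comp mHp (@pair2_measurable _ _ (R * R * R)%type R v)).
- by move=> x; exact: Hp0.
rewrite -ge0_integralZl//; last 2 first.
- have : measurable_fun setT (fun x : (R * R * R)%type =>
      (v * x.1.1, v * x.1.2, v * x.2, v)%R).
    repeat apply: measurable_fun_pair => //; apply: measurable_funM => //.
      by apply: measurableT_comp => //.
    by apply: measurableT_comp => //.
  move=> m; exact: (measurableT_comp mHp m).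
- by rewrite lee_fin exprn_ge0// ltW.
apply: eq_integral => x _.
rewrite /H /ratio_density /= EFinM muleCA.
have vV a : (v * a / v = a)%R by rewrite mulrC mulKf// gt_eqF.
by rewrite !vV -!surjective_pairing.
Qed.

End law.

(** * Bowl-shaped losses *)

Section half_line.
Context (R : realType).
Local Notation D := (`]0%R, +oo[%classic : set R).

Lemma half_lineP (x : R) : D x <-> 0 < x.
Proof. by rewrite /= in_itv /= andbT. Qed.

Lemma measurable_fun_half_line_scale d (U : measurableType d) (v : R) (h : R -> U) :
  0 < v -> measurable_fun D h -> measurable_fun D (fun x => h (v * x)).
Proof.
move=> v0 mh; apply: (measurable_comp _ _ mh) => //.
  by move=> _ [x /half_lineP x0 <-]; apply/half_lineP; rewrite mulr_gt0.
Qed.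

Lemma ge0_integral_half_line_scale (v : R) (h : R -> \bar R) :
  0 < v -> measurable_fun D h -> (forall x, 0 < x -> (0 <= h x)%E) ->
  (\int[lebesgue_measure]_(x in D) h x =
   v%:E * \int[lebesgue_measure]_(x in D) h (v * x)%R)%E.
Proof.
move=> v0 mh h0; rewrite integral_mkcond (ge0_integral_scale v0)//; last 2 first.
- exact/(measurable_restrictT _ _).1.
- by move=> x; rewrite erestrict_ge0// => y /half_lineP; exact: h0.
congr (_ * _)%E; rewrite [RHS]integral_mkcond; apply: eq_integral => x _.
rewrite !patchE; congr (if _ then _ else _).
by apply/idP/idP => /set_mem/half_lineP x0; apply/mem_set/half_lineP;
  move: x0; rewrite pmulr_rgt0.
Qed.

Lemma integrable_half_line_scale (v : R) (f : R -> R) : 0 < v ->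
  lebesgue_measure.-integrable D (EFin \o f) ->
  lebesgue_measure.-integrable D (EFin \o (fun x => f (v * x))).
Proof.
move=> v0 /integrableP[/measurable_EFinP mf foo]; apply/integrableP.
split; first by apply/measurable_EFinP; apply: measurable_fun_half_line_scale.
have /= vfoo := foo; move: vfoo.
rewrite (ge0_integral_half_line_scale v0)//; last first.
  by do 2 apply: measurableT_comp => //.
have aux (I : \bar R) : (0 <= I -> v%:E * I < +oo -> I < +oo)%E.
  by case: I => [r _ _|_|]; rewrite ?ltry// gt0_muley ?lte_fin.
by apply: aux; exact: integral_ge0.
Qed.

(** Meant for integrands containing the derivative of the loss, which change sign; the positive and
    negative parts are rescaled separately. *)
Lemma Rintegral_half_line_scale (v : R) (f : R -> R) : 0 < v ->
  lebesgue_measure.-integrable D (EFin \o f) ->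
  \int[lebesgue_measure]_(x in D) f x =
  v * \int[lebesgue_measure]_(x in D) f (v * x).
Proof.
move=> v0 fi; have fvi := integrable_half_line_scale v0 fi.
have mf : measurable_fun D (EFin \o f) := measurable_int _ fi.
rewrite -RintegralZl// /Rintegral; congr fine.
rewrite integralE [RHS]integralE; congr (_ - _)%E.
- rewrite (ge0_integral_half_line_scale v0)//; last exact: measurable_funepos.
  rewrite -ge0_integralZl//; last 2 first.
  + by apply: (@measurable_fun_half_line_scale _ _ v (EFin \o f)^\+%E) => //;
      exact: measurable_funepos.
  + by rewrite lee_fin ltW.
  apply: eq_integral => x _; rewrite !funeposE.
  by rewrite /= -!EFin_max -EFinM maxr_pMr ?ltW// mulr0.
- rewrite (ge0_integral_half_line_scale v0)//; last exact: measurable_funeneg.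
  rewrite -ge0_integralZl//; last 2 first.
  + by apply: (@measurable_fun_half_line_scale _ _ v (EFin \o f)^\-%E) => //;
      exact: measurable_funeneg.
  + by rewrite lee_fin ltW.
  apply: eq_integral => x _; rewrite !funenegE.
  by rewrite /= -!EFin_max -EFinM maxr_pMr ?ltW// mulr0 mulrN.
Qed.

End half_line.

(** Adding [e] times the identity makes [f] strictly increasing, so [incr_derive1_ge0] bounds the
    derivative below by [- e], for every [e > 0]. *)
Lemma homo_derive1_ge0 (R : realType) (f : R -> R) (D : set R) (x : R) :
  {in D° : set R, forall x, derivable f x 1} ->
  {in D &, {homo f : x y / x <= y}} -> D° x -> 0 <= derive1 f x.
Proof.
move=> df hf Dx; apply/ler_addgt0Pr => e e0.
have dx : derivable f x 1 by apply: df; rewrite inE.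
have -> : derive1 f x + e = derive1 (f + (e \*: (@id R))) x.
  have did : derivable (@id R) x 1 by exact: derivable_id.
  rewrite [RHS]derive1E (deriveD dx (derivableZ did)).
  by rewrite (deriveZ e did) derive_id derive1E scaler1.
apply: incr_derive1_ge0 Dx.
- move=> y Dy; apply: derivableD; [exact: df|exact: derivableZ].
- move=> y z Dy Dz yz; apply: ler_ltD; first by apply: hf => //; exact: ltW.
  by rewrite ltr_pM2l.
Qed.

Section bowl.
Context (R : realType) (L : R -> R).
Hypothesis dL : forall t, 0 < t -> derivable L t 1.
Hypothesis bL : bowl_shaped L.
Local Notation D := (`]0%R, +oo[%classic : set R).

Lemma bowl_ge0 t : 0 < t -> 0 <= L t.
Proof.
move=> t0; have [L1 Ld Li] := bL.
by rewrite -L1; have [t1|/ltW t1] := leP t 1; [exact: Ld|exact: Li].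
Qed.

Lemma bowl_continuous : {in D, continuous L}.
Proof.
move=> t /set_mem/half_lineP t0; apply: differentiable_continuous.
exact/derivable1_diffP/dL.
Qed.

Lemma measurable_bowl : measurable_fun D L.
Proof.
apply: open_continuous_measurable_fun; first exact: interval_open.
exact: bowl_continuous.
Qed.

Lemma bowl_derive1_ge0 t : 1 < t -> 0 <= derive1 L t.
Proof.
move=> t1; have [_ _ Li] := bL.
apply: (@homo_derive1_ge0 _ _ (`]1%R, +oo[%classic : set R)).
- move=> x; rewrite interior_itv => /set_mem; rewrite /= in_itv/= andbT => x1.
  by apply: dL; rewrite (lt_trans ltr01).
- move=> x y /set_mem; rewrite /= in_itv/= andbT => x1 _ xy.
  by apply: Li => //; exact: ltW.
- by rewrite interior_itv /= in_itv/= t1.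
Qed.

Lemma bowl_derive1_le0 t : 0 < t < 1 -> derive1 L t <= 0.
Proof.
move=> /andP[t0 t1]; have [_ Ld _] := bL.
rewrite -oppr_ge0 derive1E -deriveN -?derive1E; last exact: dL.
apply: (@homo_derive1_ge0 _ _ (`]0%R, 1%R[%classic : set R)).
- move=> x; rewrite interior_itv => /set_mem; rewrite /= in_itv/= => /andP[x0 x1].
  by apply: derivableN; exact: dL.
- move=> x y /set_mem + /set_mem; rewrite /= !in_itv/= => /andP[x0 _] /andP[_ y1] xy.
  by rewrite /= lerN2; apply: Ld => //; exact: ltW.
- by rewrite interior_itv /= in_itv/= t0 t1.
Qed.

(** Up to 1 / c both arguments lie in the decreasing branch of [L], and from 1 / c' on both lie in
    the increasing one, which gives the signs there. In between, [c * v >= 1 >= c' * v], so the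
    difference is nondecreasing and continuous; [v0] is a zero found there by the intermediate value
    theorem. *)
Lemma bowl_crossing (c' c : R) : 0 < c' -> c' < c ->
  exists2 v0, 0 < v0 & forall v, 0 < v ->
    (v < v0 -> L (c * v) <= L (c' * v)) /\ (v0 <= v -> L (c' * v) <= L (c * v)).
Proof.
move=> c'0 cc'; have c0 := lt_trans c'0 cc'; have [L1 Ld Li] := bL.
pose f v := L (c * v) - L (c' * v).
have cV : c^-1 <= c'^-1 by rewrite lef_pV2// ?posrE// ltW.
have cf : {within `[c^-1, c'^-1], continuous f}.
  apply: continuous_in_subspaceT => v /set_mem; rewrite /= in_itv/= => /andP[v1 _].
  have v0 : 0 < v by rewrite (lt_le_trans _ v1)// invr_gt0.
  have cL (a : R) : 0 < a -> {for (v : R), continuous (fun u : R => L (a * u))}.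
    move=> a0; apply: (@continuous_comp _ _ _ ( *%R a) L).
      exact: mulrl_continuous.
    by apply: bowl_continuous; apply/mem_set/half_lineP; rewrite mulr_gt0.
  by apply: continuousB; exact: cL.
have le1 v : 0 < v -> v <= c^-1 -> L (c * v) <= L (c' * v).
  move=> v0 vc; apply: Ld; rewrite ?mulr_gt0 ?ler_pM2r ?(ltW cc')//.
  by rewrite -(divff (lt0r_neq0 c0)) ler_pM2l.
have ge1 v : 0 < v -> c'^-1 <= v -> L (c' * v) <= L (c * v).
  move=> v0 vc; apply: Li; rewrite ?ler_pM2r ?(ltW cc')//.
  by rewrite -(divff (lt0r_neq0 c'0)) ler_pM2l.
have [|v0 v0I fv0] := @IVT _ f _ _ 0 cV cf.
  have fa : f c^-1 <= 0 by rewrite subr_le0 le1// invr_gt0.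
  have fb : 0 <= f c'^-1 by rewrite subr_ge0 ge1// invr_gt0.
  by rewrite ge_min fa le_max fb orbT.
move: v0I; rewrite in_itv/= => /andP[cv0 v0c'].
have v00 : 0 < v0 by rewrite (lt_le_trans _ cv0)// invr_gt0.
have mono u v : c^-1 <= u -> u <= v -> v <= c'^-1 -> f u <= f v.
  move=> cu uv vc'; have u0 : 0 < u by rewrite (lt_le_trans _ cu)// invr_gt0.
  apply: lerB.
    apply: Li; last by rewrite ler_pM2l.
    by rewrite -(divff (lt0r_neq0 c0)) ler_pM2l.
  apply: Ld; rewrite ?mulr_gt0 ?ler_pM2l//.
  by rewrite -(divff (lt0r_neq0 c'0)) ler_pM2l.
exists v0 => // v vp; split => vv0.
  have [|/ltW vc] := leP v c^-1; first exact: le1.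
  by rewrite -subr_le0 -fv0; apply: mono => //; exact: ltW.
have [vc|/ltW] := leP v c'^-1; last exact: ge1.
by rewrite -subr_ge0 -fv0; apply: mono.
Qed.

End bowl.

(** * Single crossing and gamma means *)

Section single_crossing.
Context (R : realType) (mu : {measure set R -> \bar R}).
Local Notation D := (`]0%R, +oo[%classic : set R).
Variables (a a' w h : R -> R) (v0 : R).
Hypotheses (ma : measurable_fun D a) (ma' : measurable_fun D a')
  (mw : measurable_fun D w) (mh : measurable_fun D h).
Hypotheses (a_ge0 : forall v, 0 < v -> 0 <= a v)
  (a'_ge0 : forall v, 0 < v -> 0 <= a' v)
  (w_ge0 : forall v, 0 < v -> 0 <= w v) (h_ge0 : forall v, 0 < v -> 0 <= h v).
Hypothesis h_ndecr : forall u v, 0 < u -> u <= v -> h u <= h v.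
Hypothesis v0_gt0 : 0 < v0.
Hypothesis crossing : forall v, 0 < v ->
  (v < v0 -> a v <= a' v) /\ (v0 <= v -> a' v <= a v).

(* [a - a'] changes sign at [v0] and [h] is nondecreasing, so
   [(a - a') (h - h v0) >= 0]; stated additively because the integrals may be
   infinite. *)
Lemma single_crossing_integral :
  (\int[mu]_(v in D) (a' v * (w v * h v))%:E +
     (h v0)%:E * \int[mu]_(v in D) (a v * w v)%:E <=
   \int[mu]_(v in D) (a v * (w v * h v))%:E +
     (h v0)%:E * \int[mu]_(v in D) (a' v * w v)%:E)%E.
Proof.
have m1 (f : R -> R) : measurable_fun D f -> measurable_fun D (fun v => (f v * w v)%:E).
  by move=> mf; apply/measurable_EFinP; exact: measurable_funM.
have m2 (f : R -> R) : measurable_fun D f ->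
    measurable_fun D (fun v => (f v * (w v * h v))%:E).
  by move=> mf; apply/measurable_EFinP; do 2 apply: measurable_funM => //.
have h00 := h_ge0 v0_gt0.
have p1 (f : R -> R) : (forall v, 0 < v -> 0 <= f v) ->
    forall v, D v -> (0 <= (f v * w v)%:E)%E.
  by move=> f0 v /half_lineP vp; rewrite lee_fin mulr_ge0// ?f0// w_ge0.
have p2 (f : R -> R) : (forall v, 0 < v -> 0 <= f v) ->
    forall v, D v -> (0 <= (f v * (w v * h v))%:E)%E.
  by move=> f0 v /half_lineP vp; rewrite lee_fin !mulr_ge0// ?f0// ?w_ge0// h_ge0.
have mD : measurable D by [].
have mZ (f : R -> R) : measurable_fun D f ->
    measurable_fun D (fun v => (h v0)%:E * (f v * w v)%:E)%E.
  by move=> mf; apply: measurable_funeM; exact: m1.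
have pZ (f : R -> R) : (forall v, 0 < v -> 0 <= f v) ->
    forall v, D v -> (0 <= (h v0)%:E * (f v * w v)%:E)%E.
  by move=> f0 v Dv; rewrite mule_ge0 ?p1// lee_fin.
rewrite -!ge0_integralZl ?lee_fin//; [|exact: m1|exact: p1|exact: m1|exact: p1].
rewrite -!ge0_integralD//;
  [|exact: p2|exact: m2|exact: pZ|exact: mZ|exact: p2|exact: m2|exact: pZ|exact: mZ].
apply: ge0_le_integral => //.
- by move=> v Dv; apply: adde_ge0; [exact: p2|exact: pZ].
- by apply: emeasurable_funD; [exact: m2|exact: mZ].
- by apply: emeasurable_funD; [exact: m2|exact: mZ].
move=> v /half_lineP vp; rewrite -!EFinM -!EFinD lee_fin.
have wp := w_ge0 vp; rewrite -subr_ge0.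
rewrite (_ : _ - _ = w v * ((a v - a' v) * (h v - h v0))); last by ring.
apply: mulr_ge0 => //; have [vv0|v0v] := ltP v v0.
  rewrite -mulrNN; apply: mulr_ge0; rewrite oppr_ge0 subr_le0.
    exact: (crossing vp).1.
  by apply: h_ndecr => //; exact: ltW.
by apply: mulr_ge0; rewrite subr_ge0; [exact: (crossing vp).2|exact: h_ndecr].
Qed.

Hypothesis a_fin : (\int[mu]_(v in D) (a v * w v)%:E < +oo)%E.

(** Only the integrals against [w] have to be finite: they are the ones moved across the inequality,
    while those against [w h] may be infinite. *)
Lemma le_single_crossing_integral :
  (\int[mu]_(v in D) (a' v * w v)%:E <= \int[mu]_(v in D) (a v * w v)%:E)%E ->
  (\int[mu]_(v in D) (a' v * (w v * h v))%:E <=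
   \int[mu]_(v in D) (a v * (w v * h v))%:E)%E.
Proof.
move=> le_a'a; have := single_crossing_integral.
have : (0 <= \int[mu]_(v in D) (a' v * w v)%:E)%E.
  by apply: integral_ge0 => v /half_lineP vp; rewrite lee_fin mulr_ge0 ?a'_ge0 ?w_ge0.
have := h_ge0 v0_gt0.
move: le_a'a a_fin; move: (\int[mu]_(v in D) (a v * w v)%:E)%E => A0.
move: (\int[mu]_(v in D) (a' v * w v)%:E)%E => A0'.
move: (\int[mu]_(v in D) (a v * (w v * h v))%:E)%E => B.
move: (\int[mu]_(v in D) (a' v * (w v * h v))%:E)%E => B'.
case: A0 => [x||]//; case: A0' => [y||]//; case: B => [z||]//; case: B' => [t||]//;
  rewrite ?leey ?leNye// !lee_fin => xy _ h0 y0 H.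
nra.
Qed.

Lemma lt_single_crossing_integral : 0 < h v0 ->
  (\int[mu]_(v in D) (a v * (w v * h v))%:E < +oo)%E ->
  (\int[mu]_(v in D) (a' v * w v)%:E < \int[mu]_(v in D) (a v * w v)%:E)%E ->
  (\int[mu]_(v in D) (a' v * (w v * h v))%:E <
   \int[mu]_(v in D) (a v * (w v * h v))%:E)%E.
Proof.
move=> h0 B_fin lt_a'a; have := single_crossing_integral.
have : (0 <= \int[mu]_(v in D) (a' v * w v)%:E)%E.
  by apply: integral_ge0 => v /half_lineP vp; rewrite lee_fin mulr_ge0 ?a'_ge0 ?w_ge0.
have : (0 <= \int[mu]_(v in D) (a v * (w v * h v))%:E)%E.
  apply: integral_ge0 => v /half_lineP vp.
  by rewrite lee_fin !mulr_ge0 ?a_ge0 ?w_ge0 ?h_ge0.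
move: lt_a'a B_fin a_fin; move: (\int[mu]_(v in D) (a v * w v)%:E)%E => A0.
move: (\int[mu]_(v in D) (a' v * w v)%:E)%E => A0'.
move: (\int[mu]_(v in D) (a v * (w v * h v))%:E)%E => B.
move: (\int[mu]_(v in D) (a' v * (w v * h v))%:E)%E => B'.
case: A0 => [x||]//; case: A0' => [y||]//; case: B => [z||]//; case: B' => [t||]//;
  rewrite ?ltNye// !lte_fin ?lee_fin => xy _ _ z0 y0 H.
nra.
Qed.

End single_crossing.

Section gamma.
Context (R : realType).
Local Notation D := (`]0%R, +oo[%classic : set R).

Lemma gamma_pdfE n (s x : R) : 0 < x ->
  gamma_pdf n.+1 s x = x ^+ n * expR (- (x / s)) / (n`!%:R * s ^+ n.+1).
Proof. by move=> x0; rewrite /gamma_pdf patchE mem_set//; exact/half_lineP. Qed.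

Lemma gamma_pdf1E n (x : R) : 0 < x ->
  gamma_pdf n.+1 1 x = x ^+ n * expR (- x) / n`!%:R.
Proof. by move=> x0; rewrite gamma_pdfE// expr1n divr1 mulr1. Qed.

Lemma integral_gamma_kernel n (f : R -> R) (tau : R) : 0 < tau ->
  gamma_integrable n.+1 (fun x => f (tau^-1 * x)) ->
  measurable_fun D f -> (forall x, 0 < x -> 0 <= f x) ->
  (\int[lebesgue_measure]_(x in D) (f x * (x ^+ n * expR (- (tau * x))))%:E =
   (tau^-1 ^+ n.+1 * n`!%:R * gamma_mean n.+1 (fun x => f (tau^-1 * x)))%:E)%E.
Proof.
move=> t0 fi mf f0.
have tV0 : 0 < tau^-1 by rewrite invr_gt0.
have mF : measurable_fun D (fun x => (f x * (x ^+ n * expR (- (tau * x))))%:E).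
  apply/measurable_EFinP; apply: measurable_funM => //; apply: measurable_funM.
    exact: measurable_funX.
  by apply: measurableT_comp => //; apply: measurableT_comp => //.
have F0 x : 0 < x -> (0 <= (f x * (x ^+ n * expR (- (tau * x))))%:E)%E.
  by move=> x0; rewrite lee_fin !mulr_ge0 ?f0 ?exprn_ge0 ?expR_ge0// ltW.
apply: (etrans (ge0_integral_half_line_scale tV0 mF F0)).
rewrite /gamma_mean /Rintegral EFinM fineK; last exact: integrable_fin_num.
rewrite exprS -mulrA EFinM -muleA; congr (_ * _)%E.
rewrite -integralZl//; apply: eq_integral => x /set_mem/half_lineP x0.
rewrite -EFinM; congr EFin; rewrite gamma_pdf1E// exprMn (mulVKf (lt0r_neq0 t0)).
have nf : n`!%:R != 0 :> R by rewrite pnatr_eq0 -lt0n fact_gt0.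
by field.
Qed.

End gamma.

Section gamma_mean_bowl.
Context (R : realType) (L : R -> R) (n : nat) (beta0 : R).
Hypothesis dL : forall t, 0 < t -> derivable L t 1.
Hypothesis bL : bowl_shaped L.
Hypothesis rL : regular_at_shape L n.+1.
Hypothesis beta0_gt0 : 0 < beta0.
Local Notation score := (fun beta => gamma_mean n.+2 (fun u => derive1 L (u * beta))).
Hypothesis score0 : score beta0 = 0.
Hypothesis score0_uniq : forall beta, 0 < beta -> score beta = 0 -> beta = beta0.
Local Notation D := (`]0%R, +oo[%classic : set R).

Lemma gamma_shift beta x : 0 < x ->
  x * derive1 L (beta * x) * gamma_pdf n.+1 1 x =
  n.+1%:R * (derive1 L (x * beta) * gamma_pdf n.+2 1 x).
Proof.
move=> x0; rewrite !gamma_pdf1E// factS natrM (mulrC beta) exprS.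
have nf : n`!%:R != 0 :> R by rewrite pnatr_eq0 -lt0n fact_gt0.
have n1 : n.+1%:R != 0 :> R by rewrite pnatr_eq0.
by move: (n`!%:R : R) (n.+1%:R : R) nf n1 => F N F0 N0; field; rewrite F0 N0.
Qed.

Lemma score_integrable beta : 0 < beta ->
  gamma_integrable n.+2 (fun u => derive1 L (u * beta)).
Proof.
move=> b0; have [_ i2 _] := rL b0.
have := @integrableZl _ (measurableTypeR R) R lebesgue_measure D
  (measurable_itv _) n.+1%:R^-1 _ i2.
apply: eq_integrable => // x /set_mem/half_lineP x0.
by rewrite -EFinM gamma_shift// mulKf// pnatr_eq0.
Qed.

Lemma gamma_mean_derivE beta : 0 < beta ->
  gamma_mean n.+1 (fun x => x * derive1 L (beta * x)) = n.+1%:R * score beta.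
Proof.
move=> b0; rewrite /gamma_mean -RintegralZl//; last exact: score_integrable.
by apply: eq_Rintegral => x /set_mem/half_lineP x0; rewrite gamma_shift.
Qed.

(* [L'(u beta)] changes sign once, from negative to positive, at [u = 1 / beta],
   and rescaling [u] by [beta0 / beta] multiplies the gamma density by an
   increasing function. *)
Lemma score_ge0 beta : beta0 < beta -> 0 <= score beta.
Proof.
move=> b0b; have b0 := lt_trans beta0_gt0 b0b.
pose r := beta0 / beta; have r0 : 0 < r by rewrite divr_gt0.
have r1 : r < 1 by rewrite ltr_pdivrMr// mul1r.
have bi := score_integrable b0; have b0i := score_integrable beta0_gt0.
rewrite /gamma_mean (Rintegral_half_line_scale r0 bi).
apply: mulr_ge0; first exact: ltW.
(* The rescaled density divided by the original one is r^(n+1) exp((1 - r) x), increasing in x; [K]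
   is its value at the sign change x = 1 / beta0. *)
pose K := r ^+ n.+1 * expR ((1 - r) / beta0).
have := @le_Rintegral _ (measurableTypeR R) _ lebesgue_measure D
  (fun x => K * (derive1 L (x * beta0) * gamma_pdf n.+2 1 x))
  (fun x => derive1 L (r * x * beta) * gamma_pdf n.+2 1 (r * x)) (measurable_itv _).
rewrite RintegralZl//.
rewrite -/(gamma_mean n.+2 (fun u => derive1 L (u * beta0))) score0 mulr0.
apply.
- exact: (@integrableZl _ (measurableTypeR R) R lebesgue_measure D
    (measurable_itv _) K _ b0i).
- exact: (integrable_half_line_scale r0 bi).
move=> x /half_lineP x0.
rewrite !gamma_pdf1E ?(mulr_gt0 r0 x0)//.
have -> : r * x * beta = x * beta0 by rewrite /r; field; rewrite gt_eqF.
have -> : K * (derive1 L (x * beta0) * (x ^+ n.+1 * expR (- x) / (n.+1)`!%:R)) =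
  (r ^+ n.+1 * x ^+ n.+1 / (n.+1)`!%:R) *
  (derive1 L (x * beta0) * (expR (- x) * expR ((1 - r) / beta0))) by rewrite /K; ring.
have -> : derive1 L (x * beta0) * ((r * x) ^+ n.+1 * expR (- (r * x)) / (n.+1)`!%:R) =
  (r ^+ n.+1 * x ^+ n.+1 / (n.+1)`!%:R) *
  (derive1 L (x * beta0) * (expR (- x) * expR ((1 - r) * x))).
  rewrite exprMn -expRD (_ : - x + (1 - r) * x = - (r * x)); last by ring.
  by ring.
apply: ler_wpM2l; first by rewrite !mulr_ge0 ?exprn_ge0 ?invr_ge0 ?ler0n// ltW.
have r1' : 0 <= 1 - r by rewrite subr_ge0 ltW.
have [xb|xb|xb] := ltgtP (x * beta0) 1.
- have L0 : derive1 L (x * beta0) <= 0.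
    by apply: (bowl_derive1_le0 dL bL); rewrite xb mulr_gt0.
  apply: ler_wnM2l => //; apply: ler_wpM2l; first exact: expR_ge0.
  by rewrite ler_expR; apply: ler_wpM2l => //; rewrite -div1r ler_pdivlMr// ltW.
- have L0 : 0 <= derive1 L (x * beta0) by exact: (bowl_derive1_ge0 dL bL).
  apply: ler_wpM2l => //; apply: ler_wpM2l; first exact: expR_ge0.
  by rewrite ler_expR; apply: ler_wpM2l => //; rewrite -div1r ler_pdivrMr// ltW.
- have -> : x = beta0^-1 by rewrite -div1r -xb mulfK// gt_eqF.
  exact: lexx.
Qed.

Lemma gamma_mean_lt beta : beta0 < beta ->
  gamma_mean n.+1 (fun x => L (beta0 * x)) < gamma_mean n.+1 (fun x => L (beta * x)).
Proof.
move=> b0b.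
pose M c := gamma_mean n.+1 (fun x => L (c * x)).
have dM (c : R) : 0 < c -> is_derive c 1 M (n.+1%:R * score c).
  by move=> c0; have [_ _] := rL c0; rewrite gamma_mean_derivE.
have [||c cI Mc] := @MVT R M (fun c => n.+1%:R * score c) beta0 beta b0b.
- move=> c; rewrite in_itv/= => /andP[bc _]; apply: dM; exact: lt_trans bc.
- apply: continuous_in_subspaceT => c /set_mem; rewrite /= in_itv/= => /andP[bc _].
  apply: differentiable_continuous; apply/derivable1_diffP.
  by have [] := dM c (lt_le_trans beta0_gt0 bc).
move: cI; rewrite in_itv/= => /andP[bc _].
rewrite -subr_gt0 -/(M beta) -/(M beta0) Mc mulr_gt0 ?subr_gt0// mulr_gt0//.
rewrite lt0r score_ge0// andbT.
apply/eqP => /(score0_uniq (lt_trans beta0_gt0 bc)) cb.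
by rewrite cb ltxx in bc.
Qed.

End gamma_mean_bowl.

(** * The model *)

Section densities.
Context (R : realType).

Lemma gamma_pdf_ge0 k (s x : R) : 0 < s -> 0 <= gamma_pdf k s x.
Proof.
move=> s0; rewrite /gamma_pdf patchE; case: ifPn => [/set_mem/half_lineP x0|//].
by rewrite !mulr_ge0 ?invr_ge0 ?mulr_ge0 ?exprn_ge0 ?expR_ge0// ltW.
Qed.

Lemma gamma_pdf_eq0 k (s x : R) : x <= 0 -> gamma_pdf k s x = 0.
Proof.
move=> x0; rewrite /gamma_pdf patchE memNset// => /half_lineP.
by rewrite ltNge x0.
Qed.

Lemma gamma_pdf_gt0 k (s x : R) : 0 < s -> 0 < x -> 0 < gamma_pdf k s x.
Proof.
move=> s0 x0; rewrite /gamma_pdf patchE mem_set; last exact/half_lineP.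
by rewrite !mulr_gt0 ?invr_gt0 ?mulr_gt0 ?exprn_gt0 ?expR_gt0// ltr0n fact_gt0.
Qed.

Lemma measurable_gamma_pdf k (s : R) : measurable_fun setT (gamma_pdf k s).
Proof.
apply/(measurable_restrictT _ _).1 => //.
apply: measurable_funM => //; apply: measurable_funM => //.
apply: measurableT_comp => //; apply: measurableT_comp => //.
exact: measurable_funM.
Qed.

(** Up to a positive constant, only exp(x (1 / s1 - 1 / s)) is left, and [s1 <= s] makes the
    exponent nondecreasing. *)
Lemma gamma_pdf_ratio_ndecr n (s1 s x y : R) : 0 < s1 -> s1 <= s -> 0 < x -> x <= y ->
  gamma_pdf n.+1 s x * expR (x / s1) / x ^+ n <=
  gamma_pdf n.+1 s y * expR (y / s1) / y ^+ n.
Proof.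
move=> s10 s1s x0 xy; have y0 := lt_le_trans x0 xy.
have s0 := lt_le_trans s10 s1s.
have E z : 0 < z -> gamma_pdf n.+1 s z * expR (z / s1) / z ^+ n =
    expR (z * (s1^-1 - s^-1)) / (n`!%:R * s ^+ n.+1).
  move=> z0; rewrite gamma_pdfE//.
  rewrite (_ : z * (s1^-1 - s^-1) = - (z / s) + z / s1); last by ring.
  rewrite expRD; field.
  by rewrite !expf_neq0 ?gt_eqF// ltr0n fact_gt0.
rewrite !E//; apply: ler_wpM2r.
  by rewrite invr_ge0 mulr_ge0// exprn_ge0// ltW.
rewrite ler_expR; apply: ler_wpM2r => //.
by rewrite subr_ge0 lef_pV2 ?posrE.
Qed.

Variables (n a : nat).

Lemma exp_order_stat_pdfE (mu s x : R) : mu < x ->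
  exp_order_stat_pdf n a mu s x =
  n`!%:R / ((a - 1)`!%:R * (n - a)`!%:R) *
  (1 - expR (- ((x - mu) / s))) ^+ (a - 1) * s^-1 *
  expR (- ((x - mu) / s)) ^+ (n - a + 1).
Proof.
by move=> mx; rewrite /exp_order_stat_pdf patchE mem_set//= in_itv/= andbT.
Qed.

Lemma exp_order_stat_pdf_eq0 (mu s x : R) : x <= mu ->
  exp_order_stat_pdf n a mu s x = 0.
Proof.
move=> xm; rewrite /exp_order_stat_pdf patchE memNset//=.
rewrite in_itv/= andbT => /(le_lt_trans xm).
by rewrite ltxx.
Qed.

Let expR_lt1 (mu s x : R) : 0 < s -> mu < x -> 0 < 1 - expR (- ((x - mu) / s)).
Proof.
by move=> s0 mx; rewrite subr_gt0 expR_lt1 oppr_lt0 divr_gt0// subr_gt0.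
Qed.

Lemma exp_order_stat_pdf_gt0 (mu s x : R) : 0 < s -> mu < x ->
  0 < exp_order_stat_pdf n a mu s x.
Proof.
move=> s0 mx; rewrite exp_order_stat_pdfE//.
have e0 := expR_lt1 s0 mx.
by rewrite !mulr_gt0 ?exprn_gt0 ?expR_gt0 ?invr_gt0 ?mulr_gt0 ?ltr0n ?fact_gt0.
Qed.

Lemma exp_order_stat_pdf_ge0 (mu s x : R) : 0 < s -> 0 <= exp_order_stat_pdf n a mu s x.
Proof.
move=> s0; have [xm|mx] := leP x mu; first by rewrite exp_order_stat_pdf_eq0.
by rewrite ltW// exp_order_stat_pdf_gt0.
Qed.

Lemma measurable_exp_order_stat_pdf (mu s : R) :
  measurable_fun setT (exp_order_stat_pdf n a mu s).
Proof.
have me : measurable_fun setT (fun x : R => expR (- ((x - mu) / s))).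
  do 2 apply: measurableT_comp => //; apply: measurable_funM => //.
  exact: measurable_funB.
apply/(measurable_restrictT _ _).1 => //; apply: measurable_funTS.
apply: measurable_funM; last exact: measurable_funX.
apply: measurable_funM => //; apply: measurable_funM => //.
by apply: measurable_funX; exact: measurable_funB.
Qed.

(** Below [mu] the product is 0. Above it, a constant times two nonnegative nondecreasing factors is
    left: a power of the distribution function, and an exponential with slope (n - a + 1) (1 / s1 -
    1 / s). *)
Lemma exp_order_stat_pdf_ratio_ndecr (mu s1 s x y : R) : 0 < s1 -> s1 <= s -> x <= y ->
  exp_order_stat_pdf n a mu s x * expR ((n - a + 1)%:R * x / s1) <=
  exp_order_stat_pdf n a mu s y * expR ((n - a + 1)%:R * y / s1).
Proof.
move=> s10 s1s xy; have s0 := lt_le_trans s10 s1s.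
have [xm|mx] := leP x mu.
  rewrite exp_order_stat_pdf_eq0// mul0r mulr_ge0 ?expR_ge0//.
  exact: exp_order_stat_pdf_ge0.
have my := lt_le_trans mx xy.
pose m : R := (n - a + 1)%:R.
have E z : mu < z ->
    exp_order_stat_pdf n a mu s z * expR ((n - a + 1)%:R * z / s1) =
    n`!%:R / ((a - 1)`!%:R * (n - a)`!%:R) / s *
    ((1 - expR (- ((z - mu) / s))) ^+ (a - 1) *
     expR (m * (z * (s1^-1 - s^-1) + mu / s))).
  move=> mz; rewrite exp_order_stat_pdfE// -expRM_natl -/m.
  rewrite (_ : m * (_ + _) = m * (- ((z - mu) / s)) + m * z / s1); last by ring.
  by rewrite expRD; ring.
rewrite !E//; apply: ler_wpM2l.
  by rewrite !mulr_ge0 ?invr_ge0 ?mulr_ge0// ltW.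
apply: ler_pM.
- by rewrite exprn_ge0// ltW// expR_lt1.
- exact: expR_ge0.
- apply: lerXn2r; rewrite ?nnegrE ?(ltW (expR_lt1 _ _))//.
  by rewrite lerD2l lerN2 ler_expR lerN2 ler_wpM2r ?invr_ge0 ?lerD2r// ltW.
- rewrite ler_expR; apply: ler_wpM2l => //; rewrite lerD2r; apply: ler_wpM2r => //.
  by rewrite subr_ge0 lef_pV2 ?posrE.
Qed.

End densities.

(** * Comparison of the risks for a fixed ratio vector *)

Section inner.
Context (R : realType) (L : R -> R).
Hypothesis dL : forall t, 0 < t -> derivable L t 1.
Hypothesis bL : bowl_shaped L.
Variables (p q n1 a1 n2 a2 : nat) (m1 m2 s1 s2 : R).
Hypotheses (s1_gt0 : 0 < s1) (s12 : s1 <= s2).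
Local Notation D := (`]0%R, +oo[%classic : set R).
Local Notation N := (p + q + 3)%N.
Hypothesis rL : regular_at_shape L N.+1.
Variable beta : R.
Hypothesis beta_gt0 : 0 < beta.
Hypothesis score0 : gamma_mean N.+2 (fun u => derive1 L (u * beta)) = 0.
Hypothesis score0_uniq : forall b, 0 < b ->
  gamma_mean N.+2 (fun u => derive1 L (u * b)) = 0 -> b = beta.

Local Notation os1 := (exp_order_stat_pdf n1 a1 m1 s1).
Local Notation os2 := (exp_order_stat_pdf n2 a2 m2 s2).

(** Density of (Z, V1): the order [V2], [X1], [X2], [V1] matches the components of [Zvec], with the
    common denominator last. Here [q.+1] and [p.+1] stand for b2 - a2 and b1 - a1, and [N] is the
    total power of v. *)
Definition model_density : (R * R * R * R)%type -> R :=
  ratio_density (gamma_pdf q.+1 s2) os1 os2 (gamma_pdf p.+1 s1).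

Let s2_gt0 : 0 < s2. Proof. exact: lt_le_trans s12. Qed.

(* For a fixed positive ratio vector [z], the joint density of [(Z, V1)] is [w * h],
   where [w] is the gamma kernel of rate [T / s1] and [h] is nondecreasing because
   [s1 <= s2]. *)
Section fixed_ratio.
Variable z : (R * R * R)%type.
Hypothesis z_gt0 : all_pos z.
Let z1_gt0 : 0 < z.1.1. Proof. by case/and3P: z_gt0. Qed.
Let z2_gt0 : 0 < z.1.2. Proof. by case/and3P: z_gt0. Qed.
Let z3_gt0 : 0 < z.2. Proof. by case/and3P: z_gt0. Qed.

Let T := 1 + z.1.1 + (n1 - a1 + 1)%:R * z.1.2 + (n2 - a2 + 1)%:R * z.2.
Let T_gt0 : 0 < T.
Proof.
have A0 : 0 <= (n1 - a1 + 1)%:R * z.1.2 by rewrite mulr_ge0// ltW.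
have B0 : 0 <= (n2 - a2 + 1)%:R * z.2 by rewrite mulr_ge0// ltW.
by rewrite /T; have := z1_gt0; lra.
Qed.
Let tau := T / s1.
Let tau_gt0 : 0 < tau. Proof. by rewrite divr_gt0. Qed.

Let w v := v ^+ N * expR (- (tau * v)).
(** Each marginal density is stripped of its share of [w], so that every factor is monotone by
    itself. Dividing by [(v * z.1.1) ^+ q] takes out more than the power of [v] present in [w]; the
    constant [z.1.1 ^+ q] restores the balance. The last factor is constant in [v], since [V1] has
    scale [s1]. *)
Let h v :=
  (gamma_pdf q.+1 s2 (v * z.1.1) * expR ((v * z.1.1) / s1) / (v * z.1.1) ^+ q) *
  z.1.1 ^+ q *
  (os1 (v * z.1.2) * expR ((n1 - a1 + 1)%:R * (v * z.1.2) / s1)) *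
  (os2 (v * z.2) * expR ((n2 - a2 + 1)%:R * (v * z.2) / s1)) *
  (gamma_pdf p.+1 s1 v * expR (v / s1) / v ^+ p).

Lemma model_densityE v : 0 < v -> model_density (z, v) = w v * h v.
Proof.
move=> v0; rewrite /model_density /ratio_density /joint_density /= /w /h.
rewrite (_ : tau * v = v * z.1.1 / s1 + (n1 - a1 + 1)%:R * (v * z.1.2) / s1 +
  (n2 - a2 + 1)%:R * (v * z.2) / s1 + v / s1); last first.
  by rewrite /tau /T; field; rewrite gt_eqF.
rewrite expRN !expRD exprMn !exprD.
have e0 x : expR x != 0 :> R by rewrite gt_eqF// expR_gt0.
by field; rewrite !e0 !expf_neq0 ?gt_eqF.
Qed.

Let w_ge0 v : 0 < v -> 0 <= w v.
Proof. by move=> v0; rewrite mulr_ge0 ?expR_ge0// exprn_ge0// ltW. Qed.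

Let h_ge0 v : 0 < v -> 0 <= h v.
Proof.
move=> v0; have v0' := ltW v0.
by rewrite !mulr_ge0 ?expR_ge0 ?invr_ge0 ?exprn_ge0 ?mulr_ge0 ?gamma_pdf_ge0
  ?exp_order_stat_pdf_ge0// ?ltW// mulr_gt0.
Qed.

Let h_gt0 v : m1 <= 0 -> m2 <= 0 -> 0 < v -> 0 < h v.
Proof.
move=> m10 m20 v0.
have ? := mulr_gt0 v0 z1_gt0. have z2 := mulr_gt0 v0 z2_gt0.
have z3 := mulr_gt0 v0 z3_gt0.
by rewrite !mulr_gt0 ?expR_gt0 ?invr_gt0 ?exprn_gt0 ?gamma_pdf_gt0
  ?exp_order_stat_pdf_gt0//
  (le_lt_trans _ z2, le_lt_trans _ z3).
Qed.

Let h_ndecr u v : 0 < u -> u <= v -> h u <= h v.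
Proof.
move=> u0 uv; have v0 := lt_le_trans u0 uv.
have le x : 0 < x -> u * x <= v * x by move=> x0; rewrite ler_pM2r.
have g0 k s x : 0 < s -> 0 < x -> 0 <= gamma_pdf k s x * expR (x / s1) / x ^+ k.-1.
  move=> s0 x0; rewrite !mulr_ge0 ?expR_ge0 ?gamma_pdf_ge0//.
  by rewrite invr_ge0 exprn_ge0// ltW.
have o0 n a m s x y : 0 < s -> 0 <= exp_order_stat_pdf n a m s x * expR y :> R.
  by move=> s0; rewrite mulr_ge0 ?expR_ge0 ?exp_order_stat_pdf_ge0.
have gz x : 0 < x -> 0 <= gamma_pdf q.+1 s2 (x * z.1.1) *
    expR (x * z.1.1 / s1) / (x * z.1.1) ^+ q.
  by move=> x0; apply: (g0 q.+1) => //; exact: mulr_gt0.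
have z1q : 0 <= z.1.1 ^+ q by rewrite exprn_ge0// ltW.
rewrite /h; apply: ler_pM; last exact: gamma_pdf_ratio_ndecr.
- by do ?[exact: gz | exact: o0 | exact: z1q | apply: mulr_ge0].
- exact: (g0 p.+1).
apply: ler_pM; last by apply: exp_order_stat_pdf_ratio_ndecr => //; exact: le.
- by do ?[exact: gz | exact: o0 | exact: z1q | apply: mulr_ge0].
- exact: o0.
apply: ler_pM; last by apply: exp_order_stat_pdf_ratio_ndecr => //; exact: le.
- by do ?[exact: gz | exact: z1q | apply: mulr_ge0].
- exact: o0.
apply: ler_wpM2r => //.
by apply: gamma_pdf_ratio_ndecr => //; [exact: mulr_gt0|exact: le].
Qed.

Let measurable_w : measurable_fun setT w.
Proof.
apply: measurable_funM => //; apply: measurableT_comp => //.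
by apply: measurableT_comp.
Qed.

Let measurable_h : measurable_fun setT h.
Proof.
have mc (c : R) : measurable_fun setT (fun v : R => v * c) by exact: mulrr_measurable.
have me (c : R) : measurable_fun setT (fun v : R => expR (v * c)).
  exact: measurableT_comp (mc c).
have mo n a m s c :
    measurable_fun setT (fun v : R => exp_order_stat_pdf n a m s (v * c)).
  exact: measurableT_comp (measurable_exp_order_stat_pdf _ _ _ _) (mc c).
have mg k s c : measurable_fun setT (fun v : R => gamma_pdf k s (v * c)).
  exact: measurableT_comp (measurable_gamma_pdf _ _) (mc c).
have mV n c : measurable_fun setT (fun v : R => ((v * c) ^+ n)^-1).
  by apply: measurableT_comp; [exact: measurable_invr|exact: measurable_funX].
have mk (k c : R) : measurable_fun setT (fun v : R => expR (k * (v * c) / s1)).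
  rewrite (_ : (fun _ => _) = (fun v => expR (v * (k * c / s1)))); first exact: me.
  by apply/funext => v; congr expR; ring.
have mk' (c : R) : measurable_fun setT (fun v : R => expR (v * c / s1)).
  rewrite (_ : (fun _ => _) = (fun v => expR (v * (c / s1)))); first exact: me.
  by apply/funext => v; congr expR; ring.
apply: measurable_funM; last first.
  apply: measurable_funM.
    by apply: measurable_funM => //; exact: measurable_gamma_pdf.
  by apply: measurableT_comp => //; exact: measurable_invr.
apply: measurable_funM; last exact: measurable_funM.
apply: measurable_funM; last exact: measurable_funM.
apply: measurable_funM => //; apply: measurable_funM => //.
exact: measurable_funM.
Qed.

Let bowl_scale (c : R) : 0 < c ->
  measurable_fun D (fun v => L (c * v)) /\ forall v, 0 < v -> 0 <= L (c * v).
Proof.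
move=> c0; split.
  by apply: measurable_fun_half_line_scale => //; exact: measurable_bowl.
by move=> v v0; apply: (bowl_ge0 bL); rewrite mulr_gt0.
Qed.

Let integral_w (c : R) : 0 < c ->
  (\int[leb R]_(v in D) (L (c * v) * w v)%:E =
   (tau^-1 ^+ N.+1 * N`!%:R * gamma_mean N.+1 (fun x => L (c / tau * x)))%:E)%E.
Proof.
move=> c0; have [ma a0] := bowl_scale c0.
have cE : (fun x => L (c / tau * x)) = (fun x => L (c * (tau^-1 * x))).
  by apply/funext => x; rewrite mulrA.
rewrite ge0_integral_leb//; last 2 first.
- by apply/measurable_EFinP; apply: measurable_funM => //; exact: measurable_funTS.
- by move=> v /half_lineP v0; rewrite lee_fin mulr_ge0 ?a0 ?w_ge0.
rewrite cE; apply: integral_gamma_kernel => //.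
by have [] := rL (divr_gt0 c0 tau_gt0); rewrite cE.
Qed.

(** Not normalised: the weight is the joint density of (Z, V1), so that integrating over z gives the
    risk itself. Cutting [L] to [D] discards its values at nonpositive arguments, about which
    nothing is assumed. *)
Definition conditional_risk (t : R) : \bar R :=
  (\int[leb R]_v ((L \_ D) (t * v / s1) * model_density (z, v))%:E)%E.

Let conditional_riskE (t : R) : 0 < t ->
  conditional_risk t = (\int[leb R]_(v in D) (L (t / s1 * v) * (w v * h v))%:E)%E.
Proof.
move=> t0; rewrite [RHS]integral_mkcond; apply: eq_integral => v _.
rewrite [RHS]patchE; case: ifPn => [/set_mem/half_lineP v0|vD].
  rewrite model_densityE// patchE mem_set; last first.
    by apply/half_lineP; rewrite divr_gt0// mulr_gt0.
  by rewrite mulrAC.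
rewrite /model_density /ratio_density /joint_density /=.
rewrite [gamma_pdf _ _ v]gamma_pdf_eq0 ?mulr0//.
by rewrite leNgt; apply: contra vD => v0; apply/mem_set/half_lineP.
Qed.

Let thr := threshold n1 a1 n2 a2 beta z.
Let thr_gt0 : 0 < thr. Proof. by rewrite /thr /threshold mulr_gt0. Qed.

Lemma conditional_risk_threshold (t : R) : thr < t ->
  (conditional_risk thr <= conditional_risk t)%E /\
  (m1 <= 0 -> m2 <= 0 -> (conditional_risk t < +oo)%E ->
   (conditional_risk thr < conditional_risk t)%E).
Proof.
move=> tt; have t0 := lt_trans thr_gt0 tt.
pose c' := thr / s1; pose c := t / s1.
have c'0 : 0 < c' by rewrite divr_gt0.
have c'c : c' < c by rewrite ltr_pM2r ?invr_gt0.
have c0 := lt_trans c'0 c'c.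
have [ma a0] := bowl_scale c0; have [ma' a'0] := bowl_scale c'0.
have [v0 v00 cross] := bowl_crossing dL bL c'0 c'c.
have mw : measurable_fun D w by exact: measurable_funTS.
have mh : measurable_fun D h by exact: measurable_funTS.
have w_lt : (\int[leb R]_(v in D) (L (c' * v) * w v)%:E <
    \int[leb R]_(v in D) (L (c * v) * w v)%:E)%E.
  rewrite !integral_w// lte_fin ltr_pM2l; last first.
    by rewrite mulr_gt0 ?exprn_gt0 ?invr_gt0// ltr0n fact_gt0.
  (* The threshold is [beta * T] and [tau] is [T / s1], so the multiplier [c'] becomes exactly the
     critical value [beta] after the kernel is normalised. *)
  have -> : c' / tau = beta.
    by rewrite /c' /tau /thr /threshold -/T; field; rewrite !gt_eqF.
  apply: (gamma_mean_lt dL bL rL beta_gt0 score0 score0_uniq).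
  have -> : c / tau = t / T by rewrite /c /tau; field; rewrite !gt_eqF.
  by rewrite ltr_pdivlMr.
have w_fin : (\int[leb R]_(v in D) (L (c * v) * w v)%:E < +oo)%E.
  by rewrite integral_w// ltry.
rewrite !conditional_riskE// -/c -/c'; split.
  by apply: (le_single_crossing_integral ma ma' mw mh a0 a'0 w_ge0 h_ge0
    h_ndecr v00) => //; exact: ltW.
move=> m10 m20 fin.
by apply: (lt_single_crossing_integral ma ma' mw mh a0 a'0 w_ge0 h_ge0
    h_ndecr v00) => //; exact: h_gt0.
Qed.

End fixed_ratio.
End inner.

Lemma measurable_half_space (R : realType) :
  measurable [set z : R * R * R | 0 < z.1.1].
Proof.
rewrite -[X in measurable X]setTI.
have -> : [set z : R * R * R | 0 < z.1.1] =
    (fun z : R * R * R => z.1.1) @^-1` `]0, +oo[%classic.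
  by apply/seteqP; split => z /=; rewrite in_itv/= andbT.
by apply: (measurableT_comp measurable_fst measurable_fst).
Qed.

(** * The risk as an integral over the ratio vector *)

Section model.
Context d (T : measurableType d) (R : realType) (P : probability T R).
Variables (X1 X2 V1 V2 : {mfun T >-> R}).
Variables (p q n1 a1 n2 a2 : nat) (m1 m2 s1 s2 : R).
Hypotheses (s1_gt0 : 0 < s1) (s12 : s1 <= s2).
Hypotheses (fX1 : has_density P X1 (exp_order_stat_pdf n1 a1 m1 s1))
  (fX2 : has_density P X2 (exp_order_stat_pdf n2 a2 m2 s2))
  (fV1 : has_density P V1 (gamma_pdf p.+1 s1))
  (fV2 : has_density P V2 (gamma_pdf q.+1 s2))
  (indep : independent4 P X1 X2 V1 V2).
Local Notation D := (`]0%R, +oo[%classic : set R).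
Local Notation Z := (Zvec X1 X2 V1 V2).
Local Notation density := (model_density p q n1 a1 n2 a2 m1 m2 s1 s2).

Let s2_gt0 : 0 < s2. Proof. exact: lt_le_trans s12. Qed.

Lemma measurable_model_density : measurable_fun setT density.
Proof.
by apply: measurable_ratio_density; [exact: measurable_gamma_pdf
  |exact: measurable_exp_order_stat_pdf|exact: measurable_exp_order_stat_pdf
  |exact: measurable_gamma_pdf].
Qed.

Lemma model_density_ge0 x : 0 <= density x.
Proof.
apply: ratio_density_ge0 => [y|y|y|y|y].
- exact: gamma_pdf_ge0.
- exact: exp_order_stat_pdf_ge0.
- exact: exp_order_stat_pdf_ge0.
- exact: gamma_pdf_ge0.
- exact: gamma_pdf_eq0.
Qed.

Lemma ge0_integral_Zvec (G : (R * R * R * R)%type -> \bar R) :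
  measurable_fun setT G -> (forall x, (0 <= G x)%E) ->
  (\int[P]_w G (Z w, V1 w) =
   \int[leb3 R]_z \int[leb R]_v (G (z, v) * (density (z, v))%:E))%E.
Proof.
move=> mG G0; apply: (@ge0_integral_ratio_density _ _ _ P V2 X1 X2 V1) => //.
- exact: measurable_gamma_pdf.
- exact: measurable_exp_order_stat_pdf.
- exact: measurable_exp_order_stat_pdf.
- exact: measurable_gamma_pdf.
- by move=> x; exact: gamma_pdf_ge0.
- by move=> x; exact: exp_order_stat_pdf_ge0.
- by move=> x; exact: exp_order_stat_pdf_ge0.
- by move=> x; exact: gamma_pdf_ge0.
- move=> A1 A2 A3 A4 mA1 mA2 mA3 mA4.
  rewrite [RHS](_ : _ =
    P (X1 @^-1` A2) * P (X2 @^-1` A3) * P (V1 @^-1` A4) *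
    P (V2 @^-1` A1))%E; last first.
    by rewrite -!muleA muleC -!muleA.
  rewrite -indep//; congr (P _).
  by rewrite -!setIA [LHS]setIC -!setIA.
- by move=> v; exact: gamma_pdf_eq0.
Qed.

Let measurable_rv (Y : {mfun T >-> R}) A : measurable A -> measurable (Y @^-1` A).
Proof. by move=> mA; rewrite -[X in measurable X]setTI; exact: measurable_funP. Qed.

(** Off this null set Z lies in [H], the only region where the estimating functions are assumed
    measurable and positive. *)
Let nonpos := V1 @^-1` `]-oo, 0%R]%classic `|` V2 @^-1` `]-oo, 0%R]%classic.

Let measurable_nonpos : measurable nonpos.
Proof. by apply: measurableU; exact: measurable_rv. Qed.

Let nonpos0 : P nonpos = 0%E.
Proof.
have V0 (V : {mfun T >-> R}) k s : has_density P V (gamma_pdf k s) ->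
    P (V @^-1` `]-oo, 0%R]%classic) = 0%E.
  move=> fV; apply: (etrans (fV _ (measurable_itv _))).
  by rewrite integral0_eq// => x; rewrite /= in_itv/= => x0; rewrite gamma_pdf_eq0.
apply: etrans (measureU0 _ _ (V0 _ _ _ fV2)) (V0 _ _ _ fV1); exact: measurable_rv.
Qed.

Let nonposC w : (~` nonpos) w -> 0 < V1 w /\ 0 < V2 w.
Proof.
move=> /not_orP[]; rewrite /= !in_itv/= => /negP h1 /negP h2.
by rewrite !ltNge.
Qed.

Variable L : R -> R.
Hypothesis dL : forall t, 0 < t -> derivable L t 1.
Hypothesis bL : bowl_shaped L.
Local Notation H := [set z : (R * R * R)%type | 0 < z.1.1].
Local Notation crisk psi z :=
  (conditional_risk L p q n1 a1 n2 a2 m1 m2 s1 s2 z ((psi \_ H) z)).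

Let measurable_H : measurable H. Proof. exact: measurable_half_space. Qed.

(** Outside [H] the restriction of [psi] is 0, which is not in [D], so the kernel vanishes there. It
    is thus measurable and nonnegative everywhere, and almost surely equal to the true loss. *)
Let loss_kernel (psi : (R * R * R)%type -> R) (x : (R * R * R * R)%type) : \bar R :=
  ((L \_ D) ((psi \_ H) x.1 * x.2 / s1))%:E.

Let loss_kernel_ge0 psi x : (0 <= loss_kernel psi x)%E.
Proof.
rewrite lee_fin patchE; case: ifPn => // /set_mem/half_lineP; exact: bowl_ge0.
Qed.

Let measurable_loss_kernel psi : measurable_fun H psi ->
  measurable_fun setT (loss_kernel psi).
Proof.
move=> mpsi; apply/measurable_EFinP; apply: measurableT_comp.
  by apply/(measurable_restrictT _ _).1 => //; exact: measurable_bowl.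
apply: measurable_funM => //; apply: measurable_funM => //.
by apply: measurableT_comp => //; apply/(measurable_restrictT _ _).1.
Qed.

Lemma measurable_conditional_risk (psi : (R * R * R)%type -> R) :
  measurable_fun H psi ->
  measurable_fun setT (fun z => crisk psi z).
Proof.
move=> mpsi.
have mk := measurable_loss_kernel mpsi.
apply: (@measurable_integral1 _ _ (R * R * R)%type R R (leb R)
  (fun x => loss_kernel psi x * (density x)%:E)%E).
  apply: emeasurable_funM => //; apply/measurable_EFinP.
  exact: measurable_model_density.
by move=> x; rewrite mule_ge0// lee_fin model_density_ge0.
Qed.

Lemma conditional_risk_ge0 (psi : (R * R * R)%type -> R) z : (0 <= crisk psi z)%E.
Proof.
apply: integral_ge0 => v _; rewrite EFinM mule_ge0 ?lee_fin ?model_density_ge0//.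
exact: (loss_kernel_ge0 psi (z, v)).
Qed.

Lemma expectation_ratio_estimator (psi : (R * R * R)%type -> R) :
  measurable_fun H psi ->
  (forall z, 0 < z.1.1 -> 0 < psi z) ->
  (\int[P]_w (L (psi (Z w) * V1 w / s1))%:E = \int[leb3 R]_z crisk psi z)%E.
Proof.
move=> mpsi psi0.
rewrite -(ge0_integral_Zvec (measurable_loss_kernel mpsi)); last exact: loss_kernel_ge0.
(* The true loss need not be measurable on [nonpos], so the null set is removed from both integrals
   before they are compared pointwise. *)
rewrite (integral_setC_null _ measurable_nonpos nonpos0).
rewrite [RHS](integral_setC_null _ measurable_nonpos nonpos0).
apply: eq_integral => w /set_mem/nonposC[V1w V2w].
have Hw : H (Z w) by rewrite /= /Z1 divr_gt0.
rewrite /loss_kernel [(psi \_ H) _]patchE mem_set// patchE mem_set//.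
by apply/half_lineP; rewrite divr_gt0// mulr_gt0// psi0.
Qed.

(** The law of Z is absolutely continuous. By contraposition, an event of positive probability under
    one parameter is not Lebesgue-null, a fact that no longer mentions the parameter. *)
Lemma prob_Zvec_eq0 (S : set (R * R * R)%type) :
  measurable S -> leb3 R S = 0%E -> P (Z @^-1` S) = 0%E.
Proof.
move=> mS S0.
have mV : measurable_fun setT (fun w => (V1 w)^-1).
  by apply: measurableT_comp => //; exact: measurable_invr.
have mZ : measurable_fun setT Z.
  by repeat apply: measurable_fun_pair; apply: measurable_funM.
have mZS : measurable (Z @^-1` S) by rewrite -[X in measurable X]setTI; exact: mZ.
have mS1 : measurable_fun setT (fun x : (R * R * R * R)%type => (\1_S x.1)%:E : \bar R).
  by apply/measurable_EFinP; apply: measurableT_comp => //; exact: measurable_indic.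
have S1_ge0 (x : (R * R * R * R)%type) : (0 <= (\1_S x.1)%:E :> \bar R)%E.
  by rewrite lee_fin.
rewrite -[X in P X]setIT -integral_indic//.
apply: (etrans (ge0_integral_Zvec mS1 S1_ge0)) => /=.
have md := measurable_model_density.
have mI : measurable_fun setT (fun z =>
    (\int[leb R]_v ((\1_S z)%:E * (density (z, v))%:E))%E).
  apply: (@measurable_integral1 _ _ (R * R * R)%type R R (leb R)
    (fun x => (\1_S x.1)%:E * (density x)%:E)%E).
    by apply: emeasurable_funM => //; exact/measurable_EFinP.
  by move=> x; rewrite mule_ge0// lee_fin ?model_density_ge0.
rewrite (ge0_negligible_integral mS measurableT mI _ S0); last first.
  move=> z _; apply: integral_ge0 => v _.
  by rewrite mule_ge0// lee_fin ?model_density_ge0.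
apply: integral0_eq => z [_ zS]; apply: integral0_eq => v _.
by rewrite indicE memNset// mul0e.
Qed.

End model.

(** * Positivity and measurability of the truncated estimator *)

Section truncated_estimator.
Context (R : realType) (n1 a1 n2 a2 : nat) (beta : R).
Variable phi : R * R * R -> R.
Local Notation H := [set z : R * R * R | 0 < z.1.1].
Local Notation thr := (threshold n1 a1 n2 a2 beta).
Hypothesis measurable_phi : measurable_fun H phi.
Hypothesis phi_gt0 : forall z, 0 < z.1.1 -> 0 < phi z.
Hypothesis beta_gt0 : 0 < beta.

(** Joins both branches of the improved estimator into one function of z, so that the same risk
    formula serves it and the original. *)
Definition truncated (z : R * R * R) : R :=
  if all_pos z then phi3_star n1 a1 n2 a2 beta phi z else phi z.

Lemma threshold_gt0 z : all_pos z -> 0 < thr z.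
Proof.
move=> /and3P[z1 z2 z3]; rewrite /threshold mulr_gt0//.
have A0 : 0 <= (n1 - a1 + 1)%:R * z.1.2 by rewrite mulr_ge0// ltW.
have B0 : 0 <= (n2 - a2 + 1)%:R * z.2 by rewrite mulr_ge0// ltW.
by lra.
Qed.

Lemma truncated_gt0 z : 0 < z.1.1 -> 0 < truncated z.
Proof.
move=> z0; rewrite /truncated; case: ifPn => [zp|_]; last exact: phi_gt0.
by rewrite /phi3_star lt_min phi_gt0// threshold_gt0.
Qed.

Let mz1 : measurable_fun H (fun z : R * R * R => z.1.1).
Proof. exact: (measurable_funTS (measurableT_comp measurable_fst measurable_fst)). Qed.
Let mz2 : measurable_fun H (fun z : R * R * R => z.1.2).
Proof. exact: (measurable_funTS (measurableT_comp measurable_snd measurable_fst)). Qed.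
Let mz3 : measurable_fun H (fun z : R * R * R => z.2).
Proof. exact: (measurable_funTS measurable_snd). Qed.

Let measurable_all_pos : measurable_fun H (@all_pos R).
Proof.
by apply: measurable_and; last apply: measurable_and; apply: measurable_fun_ltr.
Qed.

Let measurable_threshold : measurable_fun H thr.
Proof.
apply: measurable_funM => //; apply: measurable_funD; last exact: measurable_funM.
apply: measurable_funD; last exact: measurable_funM.
exact: measurable_funD.
Qed.

Lemma measurable_truncated : measurable_fun H truncated.
Proof.
apply: measurable_fun_if => //; first exact: measurable_half_space.
  apply: (measurable_funS (@measurable_half_space R)); first by move=> z [].
  exact: measurable_minr.
by apply: (measurable_funS (@measurable_half_space R)) => // z [].
Qed.

Lemma measurable_truncation_event :
  measurable [set z | all_pos z /\ thr z < phi z].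
Proof.
(* Intersecting with [H] loses nothing, as [all_pos] forces [0 < z.1.1], and brings the event to
   where [phi] is measurable. *)
have -> : [set z | all_pos z /\ thr z < phi z] =
    H `&` (fun z => all_pos z && (thr z < phi z)) @^-1` [set true].
  apply/seteqP; split => z /=.
    by move=> [zp ->]; rewrite zp; case/and3P: zp.
  by move=> [_ /andP].
have : measurable_fun H (fun z => all_pos z && (thr z < phi z)).
  by apply: measurable_and => //; exact: measurable_fun_ltr.
by apply => //; exact: measurable_half_space.
Qed.

End truncated_estimator.

Theorem theorem2p5 (R : realType) (a1 b1 n1 a2 b2 n2 : nat)
  (ha1 : (1 <= a1)%N) (hab1 : (a1 < b1)%N) (hbn1 : (b1 <= n1)%N)
  (ha2 : (1 <= a2)%N) (hab2 : (a2 < b2)%N) (hbn2 : (b2 <= n2)%N)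
  (d : measure_display) (T : measurableType d)
  (P : exp_param R -> probability T R) (X1 X2 V1 V2 : {mfun T >-> R})
  (hmodel : censored_exp_model a1 b1 n1 a2 b2 n2 P X1 X2 V1 V2)
  (L : R -> R)
  (hLdiff : forall t, 0 < t -> derivable L t 1)
  (hLbowl : bowl_shaped L)
  (hLreg : regular_at_shape L ((b1 + b2) - (a1 + a2) + 2))
  (phi3 : R * R * R -> R)
  (hphi3_meas : measurable_fun [set z : R * R * R | 0 < z.1.1] phi3)
  (hphi3_pos : forall z, 0 < z.1.1 -> 0 < phi3 z)
  (hrisk_fin : forall theta, in_Theta theta ->
     (risk P L theta (delta_phi3 X1 X2 V1 V2 phi3) < +oo)%E)
  (beta2 : R) (hbeta2_pos : 0 < beta2)
  (hbeta2 : gamma_mean ((b1 + b2) - (a1 + a2) + 3)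
              (fun u => derive1 L (u * beta2)) = 0)
  (hbeta2_uniq : forall beta : R, 0 < beta ->
     gamma_mean ((b1 + b2) - (a1 + a2) + 3) (fun u => derive1 L (u * beta)) = 0 ->
     beta = beta2)
  (hevent : exists theta, in_Theta theta /\
     P theta [set w | all_pos (Zvec X1 X2 V1 V2 w) /\
                threshold n1 a1 n2 a2 beta2 (Zvec X1 X2 V1 V2 w)
                  < phi3 (Zvec X1 X2 V1 V2 w)] <> 0%E) :
  dominates P L (delta_phi3_star n1 a1 n2 a2 X1 X2 V1 V2 beta2 phi3)
    (delta_phi3 X1 X2 V1 V2 phi3).
Proof.
(* The shapes b_i - a_i are positive because [a1 < b1] and [a2 < b2], hence successors; b - a + 2
   and b - a + 3 then become [N.+1] and [N.+2] with [N = p + q + 3]. *)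
pose p := (b1 - a1).-1; pose q := (b2 - a2).-1.
have pE : (b1 - a1 = p.+1)%N by rewrite /p; lia.
have qE : (b2 - a2 = q.+1)%N by rewrite /q; lia.
have kE : ((b1 + b2) - (a1 + a2) = p + q + 2)%N by rewrite /p /q; lia.
have k2 : ((b1 + b2) - (a1 + a2) + 2 = (p + q + 3).+1)%N by rewrite kE; lia.
have k3 : ((b1 + b2) - (a1 + a2) + 3 = (p + q + 3).+2)%N by rewrite kE; lia.
rewrite k2 in hLreg; rewrite k3 in hbeta2 hbeta2_uniq.
pose psi := truncated n1 a1 n2 a2 beta2 phi3.
pose Z := Zvec X1 X2 V1 V2.
pose H := [set z : R * R * R | 0 < z.1.1].
pose S := [set z | all_pos z /\ threshold n1 a1 n2 a2 beta2 z < phi3 z].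
have mS : measurable S by exact: measurable_truncation_event.
have mpsi : measurable_fun H psi by exact: measurable_truncated.
have psi_gt0 z : 0 < z.1.1 -> 0 < psi z by exact: truncated_gt0.
have psiE : delta_phi3_star n1 a1 n2 a2 X1 X2 V1 V2 beta2 phi3 =
    fun w => psi (Z w) * V1 w.
  by apply/funext => w; rewrite /delta_phi3_star /psi /truncated; case: ifPn.
pose crisk theta (f : R * R * R -> R) z := conditional_risk L p q n1 a1 n2 a2
  (mu1 theta) (mu2 theta) (sigma1 theta) (sigma2 theta) z ((f \_ H) z).
have riskE theta (f : R * R * R -> R) : in_Theta theta -> measurable_fun H f ->
    (forall z, 0 < z.1.1 -> 0 < f z) ->
    risk P L theta (fun w => f (Z w) * V1 w) =
    (\int[leb3 R]_z crisk theta f z)%E.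
  move=> htheta mf f_gt0; have [s0 s12] := htheta.
  have [fX1 fX2 fV1 fV2 indep] := hmodel _ htheta.
  rewrite pE in fV1; rewrite qE in fV2; rewrite /risk unlock.
  exact: (expectation_ratio_estimator s0 s12 fX1 fX2 fV1 fV2 indep).
have m_crisk theta (f : R * R * R -> R) : in_Theta theta -> measurable_fun H f ->
    measurable_fun setT (crisk theta f).
  by move=> [s0 s12] mf; exact: measurable_conditional_risk.
have crisk_ge0 theta (f : R * R * R -> R) z :
    in_Theta theta -> (0 <= crisk theta f z)%E.
  by move=> [s0 s12]; exact: conditional_risk_ge0.
have crisk_cmp theta z : in_Theta theta -> S z ->
    (crisk theta psi z <= crisk theta phi3 z)%E /\
    (mu1 theta <= 0 -> mu2 theta <= 0 -> (crisk theta phi3 z < +oo)%E ->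
     (crisk theta psi z < crisk theta phi3 z)%E).
  move=> [s0 s12] [zp tz]; have Hz : H z by case/and3P: zp.
  rewrite /crisk !patchE mem_set// /psi /truncated zp /phi3_star min_r ?(ltW tz)//.
  exact: (conditional_risk_threshold hLdiff hLbowl (mu1 theta) (mu2 theta)
    s0 s12 hLreg hbeta2_pos hbeta2 hbeta2_uniq zp tz).
have crisk_le theta z :
    in_Theta theta -> (crisk theta psi z <= crisk theta phi3 z)%E.
  move=> htheta; have [Sz|Sz] := pselect (S z).
    exact: (crisk_cmp _ _ htheta Sz).1.
  rewrite /crisk !patchE /psi /truncated /phi3_star.
  have [zp|//] := boolP (all_pos z); rewrite min_l// leNgt.
  by apply/negP => tz; apply: Sz.
rewrite psiE; split=> [theta htheta|].
  rewrite !riskE//; apply: ge0_le_integral => //.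
  - by move=> z _; exact: crisk_ge0.
  - exact: m_crisk.
  - exact: m_crisk.
  - by move=> z _; exact: crisk_le.
(* At [mu1 = mu2 = 0] the density is positive on the whole positive orthant, so
   the factor [h] does not vanish and the improvement is strict. *)
have htheta1 : in_Theta (ExpParam 0 0 1 1 : exp_param R) by split => //=.
exists (ExpParam 0 0 1 1); split => //.
have [theta0 [htheta0 P0]] := hevent.
(* The parameter supplied by [hevent] need not be the one just chosen; it serves only to show that
   [S] has positive Lebesgue measure. *)
have S0 : leb3 R S <> 0%E.
  move=> S0; apply: P0; have [s0 s12] := htheta0.
  have [fX1 fX2 fV1 fV2 indep] := hmodel _ htheta0.
  rewrite pE in fV1; rewrite qE in fV2.
  exact: (prob_Zvec_eq0 s0 s12 fX1 fX2 fV1 fV2 indep mS S0).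
(* Finite risk of the original estimator is what makes a pointwise strict gap on [S] survive
   integration. *)
have := hrisk_fin _ htheta1; rewrite !riskE// => fin.
apply: (lt_integral_on mS S0) => //.
- exact: m_crisk.
- exact: m_crisk.
- by move=> z; exact: crisk_ge0.
- by move=> z; exact: crisk_le.
- by move=> z Sz; apply: (crisk_cmp _ _ htheta1 Sz).2 => /=.
Qed.
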